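(* Consider problem (P): $\min_{x\in H} f(x)+g(x)+\sum_{i=1}^m h_i(B_ix)$ under the standing assumptions below. Let $w_1,\dots,w_m\in(0,1)$ with $\sum_{i=1}^m w_i=1$, let $\gamma\in(0,2/L)$ and let $\sigma,\tau>0$ satisfy $\sigma\tau<1/\sum_{i=1}^m w_i\|B_i\|^2$. Given arbitrary $x^0\in H$ and $y_i^0\in G_i$ ($i=1,\dots,m$), define for $k\ge0$ $$x^{k+1}=\operatorname{prox}_{\frac{\tau\gamma}{1+\tau}g}\Big(\frac{x^k-\tau\sum_{i=1}^m w_iB_i^*y_i^k+\tau\big(x^k-\gamma\nabla f(x^k)\big)}{1+\tau}\Big),$$ $$y_i^{k+1}=\frac{\gamma}{w_i}\operatorname{prox}_{w_i\frac{\sigma}{\gamma}h_i^*}\Big(\frac{w_i}{\gamma}\big(y_i^k+\sigma B_i(2x^{k+1}-x^k)\big)\Big),\quad i=1,\dots,m.$$ Then $\{x^k\}$ converges weakly to a solution of (P).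
   Context: Standing assumptions: $H$ and $G_1,\dots,G_m$ are real Hilbert spaces; $f:H\to\mathbb R$ is convex and differentiable with $L$-Lipschitz continuous gradient for some $L\in(0,\infty)$; $g\in\Gamma_0(H)$; $h_i\in\Gamma_0(G_i)$ and $B_i:H\to G_i$ is a bounded linear operator for each $i$; there exists $\hat x\in H$ with $0\in\nabla f(\hat x)+\partial g(\hat x)+\sum_{i=1}^m B_i^*\partial h_i(B_i\hat x)$. $\Gamma_0(X)$ is the set of proper lsc convex functions on $X$; $\operatorname{prox}_{\lambda\varphi}(u)=\arg\min_x\{\tfrac12\|x-u\|^2+\lambda\varphi(x)\}$; $\varphi^*$ is the Fenchel conjugate; $B_i^*$ is the adjoint of $B_i$ and $\|B_i\|$ its operator norm. *)

(* Defs.v *)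
From Stdlib Require Import Reals Classical ClassicalEpsilon.
Open Scope R_scope.
Set Implicit Arguments.

Record Hilbert := {
  hcar :> Type;
  hzero : hcar;
  hadd : hcar -> hcar -> hcar;
  hopp : hcar -> hcar;
  hscal : R -> hcar -> hcar;
  hinner : hcar -> hcar -> R;
  hadd_assoc : forall x y z, hadd x (hadd y z) = hadd (hadd x y) z;
  hadd_comm : forall x y, hadd x y = hadd y x;
  hadd_0 : forall x, hadd hzero x = x;
  hadd_opp : forall x, hadd (hopp x) x = hzero;
  hscal_assoc : forall a b x, hscal a (hscal b x) = hscal (a * b) x;
  hscal_1 : forall x, hscal 1 x = x;
  hscal_distr_v : forall a x y, hscal a (hadd x y) = hadd (hscal a x) (hscal a y);
  hscal_distr_s : forall a b x, hscal (a + b) x = hadd (hscal a x) (hscal b x);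
  hinner_sym : forall x y, hinner x y = hinner y x;
  hinner_add_l : forall x y z, hinner (hadd x y) z = hinner x z + hinner y z;
  hinner_scal_l : forall a x y, hinner (hscal a x) y = a * hinner x y;
  hinner_pos : forall x, 0 <= hinner x x;
  hinner_def : forall x, hinner x x = 0 -> x = hzero;
  hcomplete : forall u : nat -> hcar,
    (forall eps, 0 < eps -> exists N, forall n p, (N <= n)%nat -> (N <= p)%nat ->
       sqrt (hinner (hadd (u n) (hopp (u p))) (hadd (u n) (hopp (u p)))) < eps) ->
    exists l, forall eps, 0 < eps -> exists N, forall n, (N <= n)%nat ->
       sqrt (hinner (hadd (u n) (hopp l)) (hadd (u n) (hopp l))) < eps
}.

Arguments hzero {_}.
Arguments hadd {_} _ _.
Arguments hopp {_} _.
Arguments hscal {_} _ _.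
Arguments hinner {_} _ _.

Definition hsub {H : Hilbert} (x y : H) : H := hadd x (hopp y).
Definition hnorm {H : Hilbert} (x : H) : R := sqrt (hinner x x).

Fixpoint hsum {H : Hilbert} (n : nat) (f : nat -> H) : H :=
  match n with O => hzero | S n => hadd (hsum n f) (f n) end.
Fixpoint rsum (n : nat) (f : nat -> R) : R :=
  match n with O => 0 | S n => rsum n f + f n end.

Inductive ereal := Fin (r : R) | PInf.

Definition eadd (a b : ereal) : ereal :=
  match a, b with Fin x, Fin y => Fin (x + y) | _, _ => PInf end.
(* scaling, used only with positive scalars *)
Definition escal (l : R) (a : ereal) : ereal :=
  match a with Fin x => Fin (l * x) | PInf => PInf end.
Definition ele (a b : ereal) : Prop :=
  match a, b with
  | Fin x, Fin y => x <= y
  | _, PInf => True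
  | PInf, Fin _ => False
  end.
Definition elt (a b : ereal) : Prop :=
  match a, b with
  | Fin x, Fin y => x < y
  | Fin _, PInf => True
  | PInf, _ => False
  end.
Fixpoint esum (n : nat) (f : nat -> ereal) : ereal :=
  match n with O => Fin 0 | S n => eadd (esum n f) (f n) end.

(* supremum of a set of reals; +oo if unbounded (or empty, which never happens below) *)
Definition esup (E : R -> Prop) : ereal :=
  match excluded_middle_informative (bound E /\ exists x, E x) with
  | left Hb => Fin (proj1_sig (completeness E (proj1 Hb) (proj2 Hb)))
  | right _ => PInf
  end.

Definition proper {H : Hilbert} (phi : H -> ereal) : Prop := exists x, phi x <> PInf.
Definition convex_e {H : Hilbert} (phi : H -> ereal) : Prop :=
  forall x y t, 0 < t < 1 ->
    ele (phi (hadd (hscal t x) (hscal (1 - t) y)))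
        (eadd (escal t (phi x)) (escal (1 - t) (phi y))).
Definition lsc {H : Hilbert} (phi : H -> ereal) : Prop :=
  forall x c, elt (Fin c) (phi x) ->
    exists d, 0 < d /\ forall y, hnorm (hsub y x) < d -> elt (Fin c) (phi y).
Definition Gamma0 {H : Hilbert} (phi : H -> ereal) : Prop :=
  proper phi /\ lsc phi /\ convex_e phi.

Definition fconj {H : Hilbert} (phi : H -> ereal) (u : H) : ereal :=
  esup (fun s => exists x r, phi x = Fin r /\ s = hinner x u - r).

Definition is_prox {H : Hilbert} (l : R) (phi : H -> ereal) (u p : H) : Prop :=
  forall x, ele (eadd (Fin (/2 * (hnorm (hsub p u))^2)) (escal l (phi p)))
                (eadd (Fin (/2 * (hnorm (hsub x u))^2)) (escal l (phi x))).

Definition subdiff {H : Hilbert} (phi : H -> ereal) (x u : H) : Prop :=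
  phi x <> PInf /\
  forall y, ele (eadd (phi x) (Fin (hinner u (hsub y x)))) (phi y).

Definition bounded_linear {H G : Hilbert} (B : H -> G) : Prop :=
  (forall x y, B (hadd x y) = hadd (B x) (B y)) /\
  (forall a x, B (hscal a x) = hscal a (B x)) /\
  (exists C, forall x, hnorm (B x) <= C * hnorm x).
Definition is_adjoint {H G : Hilbert} (B : H -> G) (Bs : G -> H) : Prop :=
  forall x y, hinner (B x) y = hinner x (Bs y).
Definition opnorm {H G : Hilbert} (B : H -> G) : R :=
  match esup (fun r => exists x, hnorm x <= 1 /\ r = hnorm (B x)) with
  | Fin r => r | PInf => 0 end.

Definition is_gradient {H : Hilbert} (f : H -> R) (df : H -> H) : Prop :=
  forall x eps, 0 < eps -> exists d, 0 < d /\ forall h, hnorm h < d ->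
    Rabs (f (hadd x h) - f x - hinner (df x) h) <= eps * hnorm h.
Definition convex_r {H : Hilbert} (f : H -> R) : Prop :=
  forall x y t, 0 <= t <= 1 ->
    f (hadd (hscal t x) (hscal (1 - t) y)) <= t * f x + (1 - t) * f y.

Definition weak_cv {H : Hilbert} (u : nat -> H) (l : H) : Prop :=
  forall v : H, Un_cv (fun k => hinner (u k) v) (hinner l v).

(* Main.v *)
(** Put on the dual side the variables [y_i] with the weighted inner product [sum_i w_i <y_i, z_i>], and
  let [C x = (B_i x)_i], so that [C^* y = sum_i w_i B_i^* y_i].  The optimality conditions of the two
  proximal steps read
    [(1/tau + 1) (x - x') - C^* y - gamma df(x) \in gamma dg(x')],
    [(y - y') / sigma + C (2 x' - x) \in D y']   with   [D = prod_i (dh_i)^-1 (w_i . / gamma)],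
  i.e. the algorithm is a forward-backward iteration in the metric
    [P(z, z) = (1/tau + 1) |x|^2 + |y|^2 / sigma - 2 <C x, y>],
  which is coercive and dominates [|x|^2] because [sigma tau sum_i w_i |B_i|^2 < 1].  Cocoercivity of
  [gamma df] (Baillon-Haddad) and [gamma L < 2] make the iteration map averaged in this metric.

  Weak convergence is obtained without weak compactness: the asymptotic center of any subsequence of
  the orbit (the minimiser of the upper limit of the squared distance to it) is a fixed point, Fejer
  monotonicity shows that all subsequences share the same center, and this forces weak convergence.
  Fixed points satisfy the primal-dual optimality conditions, hence solve (P). *)

Require Import Defs.
From Stdlib Require Import Reals Arith Lra Lia Psatz Classical ClassicalEpsilon.
Open Scope R_scope.
Set Implicit Arguments.

Lemma functional_choice (A B : Type) (R : A -> B -> Prop) :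
  (forall x, exists y, R x y) -> exists f, forall x, R x (f x).
Proof.
  intro P. exists (fun x => proj1_sig (constructive_indefinite_description _ (P x))).
  intro x. apply proj2_sig.
Qed.

(** * Hilbert space algebra and minimisation *)

Section HilbertAlgebra.
Context {H : Hilbert}.
Implicit Types x y z : H.

Lemma hinner_add_r x y z : hinner x (hadd y z) = hinner x y + hinner x z.
Proof. now rewrite hinner_sym, hinner_add_l, 2!(hinner_sym _ x). Qed.

Lemma hinner_scal_r a x y : hinner x (hscal a y) = a * hinner x y.
Proof. now rewrite hinner_sym, hinner_scal_l, (hinner_sym _ x). Qed.

Lemma hinner_0_l x : hinner hzero x = 0.
Proof. pose proof (hinner_add_l H hzero hzero x) as E. rewrite hadd_0 in E. lra. Qed.

Lemma hinner_0_r x : hinner x hzero = 0.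
Proof. rewrite hinner_sym. apply hinner_0_l. Qed.

Lemma hinner_opp_l x y : hinner (hopp x) y = - hinner x y.
Proof.
  pose proof (hinner_add_l H (hopp x) x y) as E.
  rewrite hadd_opp, hinner_0_l in E. lra.
Qed.

Lemma hinner_opp_r x y : hinner x (hopp y) = - hinner x y.
Proof. now rewrite hinner_sym, hinner_opp_l, hinner_sym. Qed.

Lemma hinner_sub_l x y z : hinner (hsub x y) z = hinner x z - hinner y z.
Proof. unfold hsub. rewrite hinner_add_l, hinner_opp_l. ring. Qed.

Lemma hinner_sub_r x y z : hinner x (hsub y z) = hinner x y - hinner x z.
Proof. unfold hsub. rewrite hinner_add_r, hinner_opp_r. ring. Qed.

Lemma hsub_0_eq x y : hsub x y = hzero -> x = y.
Proof.
  unfold hsub. intro E.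
  now rewrite <- (hadd_0 H x), hadd_comm, <- (hadd_opp H y), hadd_assoc, E, hadd_0.
Qed.

Lemma hinner_sub_eq x y : hinner (hsub x y) (hsub x y) <= 0 -> x = y.
Proof.
  intro E. apply hsub_0_eq, hinner_def, Rle_antisym; [exact E | apply hinner_pos].
Qed.

Lemma hinner_ext x y : (forall z, hinner x z = hinner y z) -> x = y.
Proof. intro E. apply hinner_sub_eq. rewrite hinner_sub_l, E. lra. Qed.

End HilbertAlgebra.

Global Hint Rewrite @hinner_add_l @hinner_add_r @hinner_scal_l @hinner_scal_r @hinner_0_l
  @hinner_0_r @hinner_opp_l @hinner_opp_r @hinner_sub_l @hinner_sub_r : hilbert.

Ltac hexpand := autorewrite with hilbert.
Ltac hvec := apply hinner_ext; intro; hexpand; try ring.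

Lemma hnorm_sqr {H : Hilbert} (x : H) : hnorm x ^ 2 = hinner x x.
Proof. unfold hnorm. apply pow2_sqrt, hinner_pos. Qed.

Lemma hnorm_ge_0 {H : Hilbert} (x : H) : 0 <= hnorm x.
Proof. apply sqrt_pos. Qed.

Lemma sqrt_lt_iff (a e : R) : 0 <= a -> 0 < e -> (sqrt a < e <-> a < e ^ 2).
Proof.
  intros Ha He. pose proof (pow2_sqrt a Ha). pose proof (sqrt_pos a). split; intro; nra.
Qed.

Lemma cauchy_schwarz {H : Hilbert} (x y : H) : Rabs (hinner x y) <= hnorm x * hnorm y.
Proof.
  pose proof (hnorm_sqr x) as Ex. pose proof (hnorm_sqr y) as Ey.
  pose proof (hnorm_ge_0 x) as Px. pose proof (hnorm_ge_0 y) as Py.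
  destruct (Req_dec (hinner y y) 0) as [E | N].
  - rewrite (hinner_def H y E). rewrite hinner_0_r, Rabs_R0. pose proof (hnorm_ge_0 (@hzero H)).
    apply Rmult_le_pos; auto.
  - assert (0 < hinner y y) by (pose proof (hinner_pos H y); lra).
    pose proof (hinner_pos H (hsub (hscal (hinner y y) x) (hscal (hinner x y) y))) as P.
    revert P. hexpand. rewrite (hinner_sym H y x). intro P.
    assert (hinner x y ^ 2 <= hinner x x * hinner y y) by nra.
    apply Rabs_le. rewrite <- Ex, <- Ey in *.
    assert (0 <= hnorm x * hnorm y) by now apply Rmult_le_pos.
    split; nra.
Qed.

Lemma hnorm_scal {H : Hilbert} (a : R) (x : H) : hnorm (hscal a x) = Rabs a * hnorm x.
Proof.
  unfold hnorm. hexpand. rewrite <- Rmult_assoc, sqrt_mult_alt by nra.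
  f_equal. apply sqrt_Rsqr_abs.
Qed.

Lemma midpoint_identity {H : Hilbert} (a x y : H) :
  let z := hsub a (hscal (/2) (hadd x y)) in
  hinner z z = / 2 * hinner (hsub a x) (hsub a x) + / 2 * hinner (hsub a y) (hsub a y)
    - / 4 * hinner (hsub x y) (hsub x y).
Proof.
  cbv zeta. hexpand. rewrite (hinner_sym H x a), (hinner_sym H y a), (hinner_sym H y x). field.
Qed.

(** Since [2 |a| <= 1 + |a|^2] and [e^2 <= e], the error is controlled by the squared norm of [a]
    alone, the quantity that the upper limits below bound. *)
Lemma sqr_perturb {H : Hilbert} (a d : H) (e : R) : hnorm d <= e -> e <= 1 ->
  hinner (hadd a d) (hadd a d) <= hinner a a + e * (2 + hinner a a).
Proof.
  intros Hd He. hexpand. rewrite (hinner_sym H d a).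
  pose proof (Rle_trans _ _ _ (Rle_abs _) (cauchy_schwarz a d)) as CS.
  rewrite <- !hnorm_sqr. pose proof (hnorm_ge_0 d). pose proof (hnorm_ge_0 a).
  assert (2 * hnorm a <= 1 + hnorm a ^ 2) by (pose proof (pow2_ge_0 (hnorm a - 1)); lra).
  assert (hnorm d * (2 * hnorm a) <= e * (1 + hnorm a ^ 2)) by (apply Rmult_le_compat; lra).
  nra.
Qed.

(* Stated for bare operations so that it can be used to build [Hilbert] records. *)
Lemma complete_of_sqr (X : Type) (q : X -> X -> R) (Hq : forall x y, 0 <= q x y) :
  (forall u : nat -> X,
    (forall e, 0 < e -> exists N, forall n p, (N <= n)%nat -> (N <= p)%nat -> q (u n) (u p) < e) ->
    exists l, forall e, 0 < e -> exists N, forall n, (N <= n)%nat -> q (u n) l < e) ->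
  forall u : nat -> X,
    (forall e, 0 < e -> exists N, forall n p, (N <= n)%nat -> (N <= p)%nat ->
       sqrt (q (u n) (u p)) < e) ->
    exists l, forall e, 0 < e -> exists N, forall n, (N <= n)%nat -> sqrt (q (u n) l) < e.
Proof.
  intros C u Hu. destruct (C u) as [l Hl].
  - intros e He. destruct (Hu (sqrt e)) as [N HN]; [now apply sqrt_lt_R0 |].
    exists N. intros n p Hn Hp. apply sqrt_lt_0_alt. now apply HN.
  - exists l. intros e He. destruct (Hl (e ^ 2)) as [N HN]; [nra |].
    exists N. intros n Hn. apply sqrt_lt_iff; auto.
Qed.

Lemma complete_sqr {H : Hilbert} (u : nat -> H) :
  (forall e, 0 < e -> exists N, forall n p, (N <= n)%nat -> (N <= p)%nat ->
     hinner (hsub (u n) (u p)) (hsub (u n) (u p)) < e) ->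
  exists l, forall e, 0 < e -> exists N, forall n, (N <= n)%nat ->
     hinner (hsub (u n) l) (hsub (u n) l) < e.
Proof.
  intro Hu. destruct (hcomplete H u) as [l Hl].
  - intros e He. destruct (Hu (e ^ 2)) as [N HN]; [nra |].
    exists N. intros n p Hn Hp. apply sqrt_lt_iff; [apply hinner_pos | auto | now apply HN].
  - exists l. intros e He. destruct (Hl (sqrt e)) as [N HN]; [now apply sqrt_lt_R0 |].
    exists N. intros n Hn. apply sqrt_lt_0_alt. now apply HN.
Qed.

(* [S x r] plays the role of [F x <= r]; working with the relation covers at once extended-valued
   functions and upper limits. *)
Lemma strongly_convex_min {H : Hilbert} (S : H -> R -> Prop) (c M : R) :
  0 < c ->
  (forall x r r', S x r -> r <= r' -> S x r') ->
  (exists x r, S x r) ->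
  (forall x r, S x r -> M <= r) ->
  (forall x y r, S x r -> S y r ->
     S (hscal (/2) (hadd x y)) (r - c * hinner (hsub x y) (hsub x y))) ->
  (forall l r, (forall e, 0 < e -> exists x, S x (r + e) /\ hnorm (hsub x l) < e) ->
     forall e, 0 < e -> S l (r + e)) ->
  exists p mu, (forall e, 0 < e -> S p (mu + e)) /\ forall x r, S x r -> mu <= r.
Proof.
  intros Hc Hup Hne Hlow Hmid Hcl.
  (* The infimum of the attained bounds is obtained as [- nu], with [nu] the supremum of their
     opposites. *)
  destruct (completeness (fun t => exists x r, S x r /\ t = - r)) as [nu [Hub Hlub]].
  { exists (- M). intros t (x & r & Hr & ->). specialize (Hlow _ _ Hr). lra. }
  { destruct Hne as (x & r & Hr). eauto. }
  assert (Hmu : forall x r, S x r -> - nu <= r).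
  { intros x r Hr. assert (- r <= nu) by (apply Hub; eauto). lra. }
  assert (Happ : forall e, 0 < e -> exists x, S x (- nu + e)).
  { intros e He. apply NNPP. intro N. assert (nu <= nu - e); [apply Hlub | lra].
    intros t (x & r & Hr & ->). apply Rnot_lt_le. intro Hlt. apply N. exists x.
    apply Hup with r; [auto | lra]. }
  destruct (functional_choice (fun n x => S x (- nu + / (INR n + 1)))) as [u Hu].
  { intro n. apply Happ, Rinv_0_lt_compat. pose proof (pos_INR n). lra. }
  assert (Hu' : forall N n, (N <= n)%nat -> S (u n) (- nu + / (INR N + 1))).
  { intros N n Hn. apply Hup with (1 := Hu n). apply Rplus_le_compat_l, Rinv_le_contravar.
    - pose proof (pos_INR N). lra.
    - apply le_INR in Hn. lra. }
  assert (Hinv : forall e, 0 < e -> exists N, / (INR N + 1) < e).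
  { intros e He. destruct (archimed_cor1 e He) as (N & HN & HN0). exists N.
    apply Rle_lt_trans with (2 := HN). apply Rinv_le_contravar; [now apply lt_0_INR | lra]. }
  destruct (complete_sqr u) as [l Hl].
  (* A midpoint cannot go below the infimum, so the gain [c |u n - u p|^2] is at most
     [/ (INR N + 1)]: the minimising sequence is Cauchy. *)
  { intros e He. destruct (Hinv (c * e)) as [N HN]; [nra |].
    exists N. intros n p Hn Hp.
    pose proof (Hmu _ _ (Hmid _ _ _ (Hu' N n Hn) (Hu' N p Hp))). nra. }
  exists l, (- nu). split; [| exact Hmu].
  apply Hcl. intros e He. destruct (Hinv e He) as [N HN].
  destruct (Hl (e ^ 2)) as [N' HN']; [nra |].
  exists (u (max N N')). split.
  - apply Hup with (1 := Hu' N (max N N') ltac:(lia)). lra.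
  - apply sqrt_lt_iff; [apply hinner_pos | auto | apply HN'; lia].
Qed.

(** * Subdifferentials, proximal points and smooth convex functions *)

Lemma subdiff_iff {H : Hilbert} (phi : H -> ereal) (x u : H) :
  subdiff phi x u <->
  exists a, phi x = Fin a /\ forall y b, phi y = Fin b -> a + hinner u (hsub y x) <= b.
Proof.
  unfold subdiff. split.
  - intros [N P]. destruct (phi x) as [a |]; [| easy]. exists a. split; [easy |].
    intros y b E. specialize (P y). now rewrite E in P.
  - intros (a & E & P). rewrite E. split; [easy |]. intro y.
    destruct (phi y) as [b |] eqn:F; simpl; auto.
Qed.

Lemma subdiff_monotone {H : Hilbert} (phi : H -> ereal) (x y u v : H) :
  subdiff phi x u -> subdiff phi y v -> 0 <= hinner (hsub x y) (hsub u v).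
Proof.
  rewrite 2!subdiff_iff. intros (a & Ea & Pa) (b & Eb & Pb).
  specialize (Pa _ _ Eb). specialize (Pb _ _ Ea). revert Pa Pb. hexpand.
  rewrite (hinner_sym H u x), (hinner_sym H u y), (hinner_sym H v x), (hinner_sym H v y). lra.
Qed.

Lemma quadratic_slope_nonneg (a b : R) :
  (forall t, 0 < t < 1 -> 0 <= t * a + t ^ 2 * b) -> 0 <= a.
Proof.
  intro P. apply Rnot_lt_le. intro Ha. pose proof (Rabs_pos b) as Pb. pose proof (Rle_abs b) as Lb.
  (* For [a < 0] this gives [t < 1] and [t |b| < - a / 2], hence [t * a + t^2 * b < 0]. *)
  set (t := - a / (2 * (- a + Rabs b))).
  assert (Et : t * (2 * (- a + Rabs b)) = - a) by (unfold t; field; lra).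
  assert (Ht : 0 < t < 1) by (split; nra).
  specialize (P t Ht). nra.
Qed.

(** Compare [p] with the points of the segment from [p] to [y]: the squared distance contributes a
    linear term and one of order [t^2], so the slope at [t = 0] is the subgradient inequality. *)
Lemma prox_subdiff {H : Hilbert} (phi : H -> ereal) (l : R) (u p : H) :
  proper phi -> convex_e phi -> 0 < l -> is_prox l phi u p ->
  subdiff phi p (hscal (/ l) (hsub u p)).
Proof.
  intros [x0 Hx0] Hc Hl Hp. apply subdiff_iff. unfold is_prox in Hp.
  destruct (phi p) as [a |] eqn:Ep.
  2:{ specialize (Hp x0). destruct (phi x0); simpl in Hp; easy. }
  exists a. split; [easy |]. intros y b Ey.
  assert (P : 0 <= l * (b - a) - hinner (hsub u p) (hsub y p)).
  { apply quadratic_slope_nonneg with (b := / 2 * hinner (hsub y p) (hsub y p)).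
    intros t Ht. specialize (Hc y p t Ht). rewrite Ep, Ey in Hc.
    specialize (Hp (hadd (hscal t y) (hscal (1 - t) p))).
    destruct (phi (hadd (hscal t y) (hscal (1 - t) p))) as [s |]; simpl in Hc, Hp; [| easy].
    revert Hp. change (hnorm ?v * (hnorm ?v * 1)) with (hnorm v ^ 2). rewrite !hnorm_sqr. hexpand.
    rewrite (hinner_sym H u p), (hinner_sym H u y), (hinner_sym H p y). nra. }
  hexpand. revert P. hexpand. intro P.
  apply Rmult_le_reg_l with l; [easy |]. field_simplify; [| lra]. lra.
Qed.

(* A subgradient provides the affine minorant that makes the proximal objective coercive. *)
Lemma subdiff_resolvent {H : Hilbert} (phi : H -> ereal) (l : R) (u x0 s0 : H) :
  lsc phi -> convex_e phi -> subdiff phi x0 s0 -> 0 < l ->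
  exists p, subdiff phi p (hscal (/ l) (hsub u p)).
Proof.
  intros Hlsc Hc Hs Hl. apply subdiff_iff in Hs. destruct Hs as (a0 & E0 & Hs).
  (* The midpoint gain [/ 8] is half of the [/ 4] of the squared norm. The lower bound minimises the
     quadratic plus the affine minorant, by completing the square at [u - l s0]. *)
  destruct (@strongly_convex_min H
    (fun x r => exists a, phi x = Fin a /\ / 2 * hinner (hsub x u) (hsub x u) + l * a <= r)
    (/ 8) (l * (a0 + hinner s0 (hsub u x0)) - / 2 * l ^ 2 * hinner s0 s0)) as (p & mu & Hp & Hmu).
  - lra.
  - intros x r r' (a & Ea & Ha) Hr. exists a. split; [easy | lra].
  - do 2 eexists. exists a0. split; [exact E0 | apply Rle_refl].
  - intros x r (a & Ea & Ha). specialize (Hs _ _ Ea).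
    pose proof (hinner_pos H (hadd (hsub x u) (hscal l s0))) as P.
    apply Rmult_le_compat_l with (r := l) in Hs; [| lra].
    revert Hs Ha P. hexpand.
    rewrite (hinner_sym H u x), (hinner_sym H s0 x), (hinner_sym H s0 u). nra.
  - intros x y r (a & Ea & Ha) (b & Eb & Hb).
    specialize (Hc x y (/ 2) ltac:(lra)). rewrite Ea, Eb in Hc.
    replace (hadd (hscal (/ 2) x) (hscal (1 - / 2) y)) with (hscal (/ 2) (hadd x y)) in Hc
      by (hvec; field).
    destruct (phi (hscal (/ 2) (hadd x y))) as [s |]; simpl in Hc; [| easy].
    exists s. split; [easy |]. revert Ha Hb. hexpand.
    rewrite (hinner_sym H u x), (hinner_sym H u y), (hinner_sym H y x). nra.
  - intros z r Hz e He.
    (* [k] is the largest value of [phi z] allowed by the bound [r + e]. If [phi z] exceeded it,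
       [phi] would exceed [k] near [z] too, and [e'] is so small that the change in the quadratic
       term cannot compensate. *)
    set (k := (r + e - / 2 * hinner (hsub z u) (hsub z u)) / l).
    assert (Ek : l * k = r + e - / 2 * hinner (hsub z u) (hsub z u)) by (unfold k; field; lra).
    destruct (classic (elt (Fin k) (phi z))) as [Hk | Hk].
    + exfalso. destruct (Hlsc _ _ Hk) as (d & Hd & Hy).
      set (e' := Rmin d (e / (2 * (1 + hnorm (hsub z u))))).
      pose proof (hnorm_ge_0 (hsub z u)) as Pn.
      assert (He' : 0 < e') by (apply Rmin_pos; [easy | apply Rdiv_lt_0_compat; lra]).
      assert (He'' : e' * (1 + hnorm (hsub z u)) <= e / 2).
      { apply Rle_trans with (e / (2 * (1 + hnorm (hsub z u))) * (1 + hnorm (hsub z u))).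
        - apply Rmult_le_compat_r; [lra | apply Rmin_r].
        - apply Req_le. field. lra. }
      destruct (Hz e' He') as (x & (a & Ea & Ha) & Hx).
      specialize (Hy x (Rlt_le_trans _ _ _ Hx (Rmin_l _ _))). rewrite Ea in Hy. simpl in Hy.
      pose proof (Rle_trans _ _ _ (Rle_abs _) (cauchy_schwarz (hsub z x) (hsub z u))) as CS.
      assert (En : hnorm (hsub z x) = hnorm (hsub x z)).
      { unfold hnorm. f_equal. hexpand. ring. }
      rewrite En in CS.
      assert (hnorm (hsub x z) * hnorm (hsub z u) <= e' * hnorm (hsub z u))
        by (apply Rmult_le_compat_r; lra).
      pose proof (hinner_pos H (hsub x z)) as P.
      assert (l * k < l * a) by (apply Rmult_lt_compat_l; lra).
      revert P CS Ha Ek. hexpand.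
      rewrite (hinner_sym H z x), (hinner_sym H u x), (hinner_sym H u z). nra.
    + destruct (phi z) as [a |]; simpl in Hk; [| tauto].
      exists a. split; [easy |]. apply Rnot_lt_le in Hk. nra.
  - exists p. apply prox_subdiff; auto.
    { exists x0. now rewrite E0. }
    intro x. destruct (Hp 1 Rlt_0_1) as (a & Ea & _). rewrite Ea.
    destruct (phi x) as [b |] eqn:Eb; simpl; auto.
    change (hnorm ?v * (hnorm ?v * 1)) with (hnorm v ^ 2). rewrite !hnorm_sqr.
    apply Rle_trans with mu.
    + apply le_epsilon. intros e He. destruct (Hp e He) as (a' & Ea' & Ha').
      rewrite Ea in Ea'. injection Ea' as Ea'. now subst a'.
    + apply Hmu with x. exists b. split; [easy | lra].
Qed.

Lemma fconj_ge {H : Hilbert} (phi : H -> ereal) (u x : H) (a b : R) :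
  phi x = Fin a -> fconj phi u = Fin b -> hinner x u - a <= b.
Proof.
  unfold fconj, esup. intro Ea.
  destruct (excluded_middle_informative _) as [P | P]; [| easy].
  destruct (completeness _ _ _) as [m [Hm Hm']]. simpl. intro E. injection E as E. rewrite <- E. apply Hm. eauto.
Qed.

(** Equality case of Fenchel-Young: the subgradient inequality bounds the set under the supremum,
    which puts [esup] in its finite branch. *)
Lemma fconj_le {H : Hilbert} (phi : H -> ereal) (u x : H) :
  subdiff phi x u ->
  exists a b, phi x = Fin a /\ fconj phi u = Fin b /\ b <= hinner x u - a.
Proof.
  intro Hs. apply subdiff_iff in Hs. destruct Hs as (a & Ea & Hs). exists a.
  assert (Hub : is_upper_bound (fun s => exists x r, phi x = Fin r /\ s = hinner x u - r)
                  (hinner x u - a)).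
  { intros s (y & r & Er & ->). specialize (Hs _ _ Er). revert Hs. hexpand.
    rewrite (hinner_sym H u x), (hinner_sym H u y). lra. }
  unfold fconj, esup. destruct (excluded_middle_informative _) as [P | P].
  - destruct (completeness _ _ _) as [m [Hm' Hm]]. simpl. eauto.
  - exfalso. apply P. split; [eexists; exact Hub |]. exists (hinner x u - a), x, a. auto.
Qed.

(* Moreau's identity: with [q] the proximal point of [phi / l] at [u / l], the point [u - l q]
   minimises the proximal objective of the conjugate, with a quadratic gain at any other point. *)
Lemma prox_fconj_subdiff {H : Hilbert} (phi : H -> ereal) (l : R) (u p x0 s0 : H) :
  lsc phi -> convex_e phi -> subdiff phi x0 s0 -> 0 < l -> is_prox l (fconj phi) u p ->
  subdiff phi (hscal (/ l) (hsub u p)) p.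
Proof.
  intros Hlsc Hc Hs Hl Hp.
  destruct (@subdiff_resolvent H phi (/ l) (hscal (/ l) u) x0 s0) as [q Hq]; auto.
  { now apply Rinv_0_lt_compat. }
  set (p' := hscal (/ / l) (hsub (hscal (/ l) u) q)) in Hq.
  assert (Eu : u = hadd p' (hscal l q)) by (unfold p'; hvec; field; lra).
  destruct (fconj_le Hq) as (a & b' & Ea & Eb' & Hb').
  specialize (Hp p'). rewrite Eb' in Hp.
  destruct (fconj phi p) as [b |] eqn:Eb; simpl in Hp; [| easy].
  pose proof (fconj_ge _ _ _ Ea Eb) as Hb.
  (* With [u = p' + l q], the Fenchel-Young bound at [p] and its equality case at [p'] reduce the
     minimality of [p] to [|p - p'|^2 <= 0]. *)
  assert (E : p = p').
  { apply hinner_sub_eq. revert Hp.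
    change (hnorm ?v * (hnorm ?v * 1)) with (hnorm v ^ 2). rewrite !hnorm_sqr.
    apply Rmult_le_compat_l with (r := l) in Hb; [| lra].
    apply Rmult_le_compat_l with (r := l) in Hb'; [| lra].
    rewrite Eu. revert Hb Hb'. hexpand.
    rewrite (hinner_sym H p' p), (hinner_sym H p q), (hinner_sym H p' q). lra. }
  replace (hscal (/ l) (hsub u p)) with q; [now rewrite E |].
  rewrite E, Eu. hvec. field. lra.
Qed.

Lemma gradient_inequality {H : Hilbert} (f : H -> R) (df : H -> H) (x z : H) :
  convex_r f -> is_gradient f df -> f x + hinner (df x) (hsub z x) <= f z.
Proof.
  intros Hc Hd. set (h := hsub z x). pose proof (hnorm_ge_0 h) as Ph.
  apply le_epsilon. intros e He.
  destruct (Hd x (e / (1 + hnorm h))) as (d & Hd0 & Hd1); [apply Rdiv_lt_0_compat; lra |].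
  (* [t <= 1] allows convexity on the segment and [t |h| < d] allows the differential estimate;
     dividing by [t] leaves an error of at most [e]. *)
  set (t := Rmin 1 (d / (2 * (1 + hnorm h)))).
  assert (Ht : 0 < t) by (apply Rmin_pos; [lra | apply Rdiv_lt_0_compat; lra]).
  assert (Ht1 : t <= 1) by apply Rmin_l.
  assert (Htd : t * (1 + hnorm h) <= d / 2).
  { apply Rle_trans with (d / (2 * (1 + hnorm h)) * (1 + hnorm h)).
    - apply Rmult_le_compat_r; [lra | apply Rmin_r].
    - apply Req_le. field. lra. }
  specialize (Hd1 (hscal t h)). rewrite hnorm_scal, (Rabs_pos_eq t) in Hd1 by lra.
  specialize (Hd1 ltac:(nra)).
  rewrite <- Rabs_Ropp in Hd1. pose proof (Rle_trans _ _ _ (Rle_abs _) Hd1) as H1.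
  specialize (Hc z x t ltac:(lra)).
  replace (hadd (hscal t z) (hscal (1 - t) x)) with (hadd x (hscal t h)) in Hc
    by (unfold h; hvec).
  rewrite hinner_scal_r in H1.
  assert (He' : e / (1 + hnorm h) * hnorm h <= e).
  { apply Rmult_le_reg_r with (1 + hnorm h); [lra |]. field_simplify; nra. }
  apply Rmult_le_reg_l with t; [easy |]. nra.
Qed.

Lemma derivable_along_line {H : Hilbert} (f : H -> R) (df : H -> H) (x h : H) (t : R) :
  is_gradient f df ->
  derivable_pt_lim (fun t => f (hadd x (hscal t h))) t (hinner (df (hadd x (hscal t h))) h).
Proof.
  intros Hd e He. pose proof (hnorm_ge_0 h) as Ph.
  destruct (Hd (hadd x (hscal t h)) (e / (2 * (1 + hnorm h)))) as (d & Hd0 & Hd1).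
  { apply Rdiv_lt_0_compat; lra. }
  assert (Hd' : 0 < d / (1 + hnorm h)) by (apply Rdiv_lt_0_compat; lra).
  exists (mkposreal _ Hd'). simpl. intros s Hs Hsd.
  pose proof (Rabs_pos_lt _ Hs) as Ps.
  specialize (Hd1 (hscal s h)). rewrite hnorm_scal, hinner_scal_r in Hd1.
  replace (hadd (hadd x (hscal t h)) (hscal s h)) with (hadd x (hscal (t + s) h)) in Hd1 by hvec.
  match goal with |- Rabs ?A < _ => assert (E : Rabs A * Rabs s <= e / 2 * Rabs s) end.
  - rewrite <- Rabs_mult.
    match goal with |- Rabs ?A <= _ => replace A with
      (f (hadd x (hscal (t + s) h)) - f (hadd x (hscal t h))
        - s * hinner (df (hadd x (hscal t h))) h) by (field; auto) end.
    eapply Rle_trans; [apply Hd1 |].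
    + apply Rmult_lt_compat_r with (r := 1 + hnorm h) in Hsd; [| lra].
      replace (d / (1 + hnorm h) * (1 + hnorm h)) with d in Hsd by (field; lra). nra.
    + apply Rle_trans with (e / (2 * (1 + hnorm h)) * (1 + hnorm h) * Rabs s).
      * assert (0 < e / (2 * (1 + hnorm h))) by (apply Rdiv_lt_0_compat; lra).
        assert (Rabs s * hnorm h <= Rabs s * (1 + hnorm h)) by nra. nra.
      * apply Req_le. field. lra.
  - apply Rmult_le_reg_r in E; [lra | easy].
Qed.

(** The mean value theorem replaces integration: subtracting the quadratic bound from [f] along the
    segment gives [psi], whose derivative is nonpositive on it by Cauchy-Schwarz and the Lipschitz
    bound. *)
Lemma descent_inequality {H : Hilbert} (f : H -> R) (df : H -> H) (L : R) (x h : H) :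
  is_gradient f df -> (forall x y, hnorm (hsub (df x) (df y)) <= L * hnorm (hsub x y)) ->
  f (hadd x h) <= f x + hinner (df x) h + L / 2 * hinner h h.
Proof.
  intros Hd HL.
  set (psi := fun t => f (hadd x (hscal t h)) - (hinner (df x) h * t + L / 2 * hinner h h * t ^ 2)).
  destruct (MVT_cor2 psi
    (fun t => hinner (df (hadd x (hscal t h))) h - (hinner (df x) h + L * hinner h h * t)) 0 1)
    as (c & E & Hc).
  - lra.
  - intros c _. apply derivable_pt_lim_minus; [now apply derivable_along_line |].
    replace (hinner (df x) h + L * hinner h h * c)
      with (hinner (df x) h * 1 + L / 2 * hinner h h * (INR 2 * c ^ 1)) by (simpl; field).
    apply derivable_pt_lim_plus; apply derivable_pt_lim_scal.
    + apply derivable_pt_lim_id.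
    + apply derivable_pt_lim_pow.
  - unfold psi in E.
    replace (hadd x (hscal 1 h)) with (hadd x h) in E by hvec.
    replace (hadd x (hscal 0 h)) with x in E by hvec.
    pose proof (Rle_trans _ _ _ (Rle_abs _)
      (cauchy_schwarz (hsub (df (hadd x (hscal c h))) (df x)) h)) as CS.
    specialize (HL (hadd x (hscal c h)) x).
    replace (hsub (hadd x (hscal c h)) x) with (hscal c h) in HL by hvec.
    rewrite hnorm_scal, Rabs_pos_eq in HL by lra.
    rewrite hinner_sub_l in CS. pose proof (hnorm_sqr h). pose proof (hnorm_ge_0 h).
    apply Rmult_le_compat_r with (r := hnorm h) in HL; [| easy]. nra.
Qed.

(** At the gradient-step point [y - d / L], with [d = df y - df x], the tangent bound from [x] lies
    below the descent bound from [y]. This sharpens the gradient inequality by [|d|^2 / (2 L)];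
    adding the two versions with [x] and [y] exchanged gives cocoercivity. *)
Lemma baillon_haddad {H : Hilbert} (f : H -> R) (df : H -> H) (L : R) (x y : H) :
  0 < L -> convex_r f -> is_gradient f df ->
  (forall x y, hnorm (hsub (df x) (df y)) <= L * hnorm (hsub x y)) ->
  / L * hinner (hsub (df x) (df y)) (hsub (df x) (df y))
    <= hinner (hsub (df x) (df y)) (hsub x y).
Proof.
  intros HL Hc Hd HLip.
  assert (P : forall x y, f x + hinner (df x) (hsub y x)
    + / (2 * L) * hinner (hsub (df y) (df x)) (hsub (df y) (df x)) <= f y).
  { clear x y. intros x y. set (d := hsub (df y) (df x)).
    pose proof (descent_inequality y (hscal (- / L) d) Hd HLip) as H1.
    pose proof (gradient_inequality x (hadd y (hscal (- / L) d)) Hc Hd) as H2.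
    assert (E : hinner (df y) d - hinner (df x) d = hinner d d) by (unfold d; hexpand; ring).
    assert (E' : / (2 * L) * hinner d d = / L * hinner d d - L / 2 * (- / L * (- / L * hinner d d)))
      by (field; lra).
    apply Rmult_eq_compat_l with (r := / L) in E. revert H1 H2. hexpand. lra. }
  pose proof (P x y) as H1. pose proof (P y x) as H2. revert H1 H2.
  replace (/ L) with (/ (2 * L) + / (2 * L)) by (field; lra). hexpand.
  rewrite (hinner_sym H (df y) (df x)). lra.
Qed.

(** * Asymptotic centers and averaged maps *)

(** Up to an arbitrarily small increase of [s], this says that the upper limit of the squared
    distances is at most [s]; it is the relation fed to [strongly_convex_min]. *)
Definition eventually_within {E : Hilbert} (a : nat -> E) (x : E) (s : R) : Prop :=
  exists N, forall k, (N <= k)%nat -> hinner (hsub (a k) x) (hsub (a k) x) <= s.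

(* [mu] is the infimum over [x] of the upper limit of the squared distances from [a k] to [x],
   attained at [p]. *)
Definition asymptotic_center {E : Hilbert} (a : nat -> E) (p : E) (mu : R) : Prop :=
  (forall e, 0 < e -> eventually_within a p (mu + e)) /\
  (forall x s, eventually_within a x s -> mu <= s).

Lemma eventually_within_mid {E : Hilbert} (a : nat -> E) (x y : E) (s : R) :
  eventually_within a x s -> eventually_within a y s ->
  eventually_within a (hscal (/2) (hadd x y)) (s - / 4 * hinner (hsub x y) (hsub x y)).
Proof.
  intros [N HN] [N' HN']. exists (max N N'). intros k Hk.
  specialize (HN k ltac:(lia)). specialize (HN' k ltac:(lia)).
  pose proof (midpoint_identity (a k) x y) as Hm. cbv zeta in Hm. lra.
Qed.

Lemma eventually_within_perturb {E : Hilbert} (a b : nat -> E) (x y : E) (s e : R) :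
  0 < e -> eventually_within a x s ->
  (forall d, 0 < d -> exists N, forall k, (N <= k)%nat ->
     hnorm (hsub (hsub (b k) y) (hsub (a k) x)) < d) ->
  eventually_within b y (s + e).
Proof.
  intros He [N HN] Hd. pose proof (Rabs_pos s) as Ps. pose proof (Rle_abs s) as Ls.
  set (d := Rmin 1 (e / (2 + Rabs s))).
  assert (Hd0 : 0 < d) by (apply Rmin_pos; [lra | apply Rdiv_lt_0_compat; lra]).
  assert (Hde : d * (2 + Rabs s) <= e).
  { apply Rle_trans with (e / (2 + Rabs s) * (2 + Rabs s)).
    - apply Rmult_le_compat_r; [lra | apply Rmin_r].
    - apply Req_le. field. lra. }
  destruct (Hd d Hd0) as [N' HN']. exists (max N N'). intros k Hk.
  specialize (HN k ltac:(lia)). specialize (HN' k ltac:(lia)).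
  pose proof (sqr_perturb (hsub (a k) x) _ (Rlt_le _ _ HN') (Rmin_l _ _)) as P.
  replace (hadd (hsub (a k) x) (hsub (hsub (b k) y) (hsub (a k) x))) with (hsub (b k) y) in P
    by hvec.
  nra.
Qed.

Lemma asymptotic_center_exists {E : Hilbert} (a : nat -> E) (z : E) (M : R) :
  eventually_within a z M -> exists p mu, asymptotic_center a p mu.
Proof.
  intro Ha. apply (@strongly_convex_min E (eventually_within a) (/ 4) 0).
  - lra.
  - intros x r r' [N HN] Hr. exists N. intros k Hk. specialize (HN k Hk). lra.
  - eauto.
  - intros x r [N HN]. eapply Rle_trans; [apply hinner_pos | apply (HN N (le_n N))].
  - intros x y r. apply eventually_within_mid.
  - intros l r Hl e He. pose proof (Rabs_pos r) as Pr. pose proof (Rle_abs r) as Lr.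
    (* The slack [d] in the bound at [x] plus the perturbation [d * (2 + r + d)] is at most
       [d * (4 + |r|)]. *)
    set (d := Rmin 1 (e / (4 + Rabs r))).
    assert (Hd1 : d <= 1) by apply Rmin_l.
    assert (Hd0 : 0 < d) by (apply Rmin_pos; [lra | apply Rdiv_lt_0_compat; lra]).
    assert (Hde : d * (4 + Rabs r) <= e).
    { apply Rle_trans with (e / (4 + Rabs r) * (4 + Rabs r)).
      - apply Rmult_le_compat_r; [lra | apply Rmin_r].
      - apply Req_le. field. lra. }
    destruct (Hl d Hd0) as (x & [N HN] & Hx). exists N. intros k Hk. specialize (HN k Hk).
    pose proof (sqr_perturb (hsub (a k) x) _ (Rlt_le _ _ Hx) Hd1) as P.
    replace (hadd (hsub (a k) x) (hsub x l)) with (hsub (a k) l) in P by hvec. nra.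
Qed.

(** The midpoint of two distinct centers would be strictly better than either. *)
Lemma asymptotic_center_unique {E : Hilbert} (a : nat -> E) (p q : E) (mu : R) :
  asymptotic_center a p mu -> (forall e, 0 < e -> eventually_within a q (mu + e)) -> p = q.
Proof.
  intros [Hp Hmu] Hq. apply hinner_sub_eq, le_epsilon. intros e He.
  pose proof (Hmu _ _ (eventually_within_mid (Hp (e / 4) ltac:(lra)) (Hq (e / 4) ltac:(lra)))).
  lra.
Qed.

Section AveragedOrbit.
Context {E : Hilbert} (T : E -> E -> Prop) (c : R) (Hc : 0 < c).
Hypothesis T_total : forall x, exists x', T x x'.
Hypothesis T_averaged : forall x x' y y', T x x' -> T y y' ->
  hinner (hsub x' y') (hsub x' y') <= hinner (hsub x y) (hsub x y)
    - c * hinner (hsub (hsub x x') (hsub y y')) (hsub (hsub x x') (hsub y y')).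
Variables (u : nat -> E) (z : E).
Hypothesis Hu : forall k, T (u k) (u (S k)).
Hypothesis Hz : T z z.

Lemma averaged_nonexpansive x x' y y' : T x x' -> T y y' ->
  hinner (hsub x' y') (hsub x' y') <= hinner (hsub x y) (hsub x y).
Proof.
  intros Hx Hy. pose proof (T_averaged Hx Hy).
  pose proof (hinner_pos E (hsub (hsub x x') (hsub y y'))). nra.
Qed.

Lemma orbit_fejer q N k : T q q -> (N <= k)%nat ->
  hinner (hsub (u k) q) (hsub (u k) q) <= hinner (hsub (u N) q) (hsub (u N) q).
Proof.
  intro Hq. induction 1 as [| k _ IH]; [lra |].
  pose proof (averaged_nonexpansive (Hu k) Hq). lra.
Qed.

(** The squared distance to the fixed point [z] decreases to a limit, and averagedness bounds
    [c |u k - u (S k)|^2] by its consecutive drops. *)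
Lemma orbit_asymptotically_regular e : 0 < e ->
  exists N, forall k, (N <= k)%nat -> hnorm (hsub (u k) (u (S k))) < e.
Proof.
  intro He.
  destruct (decreasing_cv (fun k => hinner (hsub (u k) z) (hsub (u k) z))) as [l Hl].
  - intro k. apply averaged_nonexpansive; auto.
  - exists 0. intros t [k ->]. unfold opp_seq.
    pose proof (hinner_pos E (hsub (u k) z)). lra.
  - destruct (Hl (c * e ^ 2 / 2)) as [N HN].
    { pose proof (pow_lt e 2 He). nra. }
    exists N. intros k Hk. apply sqrt_lt_iff; [apply hinner_pos | easy |].
    pose proof (HN k Hk) as H1. pose proof (HN (S k) ltac:(lia)) as H2.
    unfold Rdist in H1, H2. apply Rabs_def2 in H1, H2.
    pose proof (T_averaged (Hu k) Hz) as H3.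
    replace (hsub (hsub (u k) (u (S k))) (hsub z z)) with (hsub (u k) (u (S k))) in H3 by hvec.
    apply Rmult_lt_reg_l with c; lra.
Qed.

(** The image [q'] of [q] is as close to the shifted points [u (S (n k))] as [q] is to [u (n k)].
    Asymptotic regularity removes the shift, as [k <= n k] sends [n k] to infinity; uniqueness of
    the center gives [q' = q]. *)
Lemma asymptotic_center_fixed (n : nat -> nat) (q : E) (nu : R) :
  (forall k, (k <= n k)%nat) -> asymptotic_center (fun k => u (n k)) q nu -> T q q.
Proof.
  intros Hn Hq. destruct (T_total q) as [q' Hq'].
  enough (q = q') by now subst q'.
  apply (asymptotic_center_unique Hq). intros e He.
  replace (nu + e) with ((nu + e / 2) + e / 2) by field.
  apply eventually_within_perturb with (a := fun k => u (S (n k))) (x := q'); [lra | |].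
  - destruct (proj1 Hq (e / 2)) as [N HN]; [lra |]. exists N. intros k Hk.
    pose proof (averaged_nonexpansive (Hu (n k)) Hq'). specialize (HN k Hk). lra.
  - intros d Hd. destruct (orbit_asymptotically_regular Hd) as [N HN]. exists N. intros k Hk.
    replace (hsub (hsub (u (n k)) q') (hsub (u (S (n k))) q'))
      with (hsub (u (n k)) (u (S (n k)))) by hvec.
    apply HN. specialize (Hn k). lia.
Qed.

(* All subsequences of the orbit have the same asymptotic center [p]; if [<u k - p, v>] stayed
   above [e] along a subsequence, moving [p] slightly in the direction [v] would improve on it. *)
Lemma averaged_orbit_weak_cv : exists p, T p p /\ weak_cv u p.
Proof.
  destruct (@asymptotic_center_exists E u z (hinner (hsub (u 0%nat) z) (hsub (u 0%nat) z)))
    as (p & mu & Hp).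
  { exists 0%nat. intros k Hk. now apply orbit_fejer. }
  assert (Tp : T p p) by (apply (@asymptotic_center_fixed (fun k => k) p mu); auto).
  assert (Hup : forall v e, 0 < e ->
    exists N, forall k, (N <= k)%nat -> hinner (hsub (u k) p) v < e).
  { intros v e He. apply NNPP. intro Hno.
    destruct (functional_choice (fun N k => (N <= k)%nat /\ e <= hinner (hsub (u k) p) v)) as [n Hn].
    { intro N. apply NNPP. intro Hno'. apply Hno. exists N. intros k Hk.
      apply Rnot_le_lt. eauto. }
    assert (Hsub : forall x s, eventually_within u x s -> eventually_within (fun k => u (n k)) x s).
    { intros x s [N HN]. exists N. intros k Hk. apply HN. destruct (Hn k). lia. }
    destruct (@asymptotic_center_exists E (fun k => u (n k)) p (mu + 1)) as (q & nu & Hq).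
    { apply Hsub, Hp. lra. }
    assert (Tq : T q q).
    { apply (@asymptotic_center_fixed n q nu); [| easy]. intro k. apply Hn. }
    (* As [q] is a fixed point, its distance bound at the single index [n N] persists along the rest
       of the full orbit. *)
    assert (Hmn : mu <= nu).
    { apply le_epsilon. intros e' He'. destruct (proj1 Hq e' He') as [N HN].
      apply (proj2 Hp q). exists (n N). intros k Hk.
      eapply Rle_trans; [now apply orbit_fejer with (N := n N) | now apply HN]. }
    (* With this step [t^2 |v|^2 = t e - t^2], so [p + t v] gives [nu <= mu - t e / 2 - t^2],
       against [mu <= nu]. *)
    set (t := e / (1 + hinner v v)). pose proof (hinner_pos E v) as Pv.
    assert (Ht : 0 < t) by (apply Rdiv_lt_0_compat; lra).
    assert (Et : t * (1 + hinner v v) = e) by (unfold t; field; lra).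
    assert (Hlt : nu <= mu + t * e / 2 - 2 * t * e + t ^ 2 * hinner v v).
    { apply (proj2 Hq (hadd p (hscal t v))).
      destruct (Hsub _ _ (proj1 Hp (t * e / 2) ltac:(nra))) as [N HN].
      exists N. intros k Hk. specialize (HN k Hk). destruct (Hn k) as [_ Hk'].
      apply Rmult_le_compat_l with (r := t) in Hk'; [| lra].
      revert HN Hk'. hexpand.
      rewrite (hinner_sym E p (u (n k))), (hinner_sym E v (u (n k))), (hinner_sym E v p). lra. }
    assert (t ^ 2 * hinner v v = t * e - t ^ 2) by (rewrite <- Et; ring).
    nra. }
  exists p. split; [easy |]. intros v e He.
  destruct (Hup v e He) as [N HN]. destruct (Hup (hopp v) e He) as [N' HN'].
  exists (max N N'). intros k Hk. specialize (HN k ltac:(lia)). specialize (HN' k ltac:(lia)).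
  revert HN HN'. hexpand. intros. unfold Rdist. apply Rabs_def1; lra.
Qed.

End AveragedOrbit.

(** The representing vector is the minimiser of [|x|^2 / 2 - ell x]: the first-order condition in
    the directions [x] and [- x] is the representation formula. *)
Lemma riesz {E : Hilbert} (ell : E -> R) (C : R) :
  (forall x y, ell (hadd x y) = ell x + ell y) -> (forall a x, ell (hscal a x) = a * ell x) ->
  (forall x, Rabs (ell x) <= C * hnorm x) ->
  exists z, forall x, ell x = hinner x z.
Proof.
  intros Hadd Hscal HC.
  assert (Hsub : forall x y, ell (hsub x y) = ell x - ell y).
  { intros x y. replace (hsub x y) with (hadd x (hscal (-1) y)) by hvec.
    rewrite Hadd, Hscal. ring. }
  assert (HC' : forall x, Rabs (ell x) <= Rabs C * hnorm x).
  { intro x. eapply Rle_trans; [apply HC |].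
    apply Rmult_le_compat_r; [apply hnorm_ge_0 | apply Rle_abs]. }
  clear HC. pose proof (Rabs_pos C) as PC. set (K := Rabs C) in *. clearbody K. clear C.
  destruct (@strongly_convex_min E (fun x r => / 2 * hinner x x - ell x <= r)
    (/ 8) (- / 2 * K ^ 2)) as (z & mu & Hz & Hmu).
  - lra.
  - intros; lra.
  - do 2 eexists. apply (Rle_refl (/ 2 * hinner hzero hzero - ell hzero)).
  - intros x r Hr. pose proof (Rle_trans _ _ _ (Rle_abs _) (HC' x)).
    rewrite <- hnorm_sqr in Hr. pose proof (pow2_ge_0 (hnorm x - K)). nra.
  - intros x y r Hx Hy. rewrite Hscal, Hadd. revert Hx Hy. hexpand.
    rewrite (hinner_sym E y x). lra.
  - intros l r Hl e He. pose proof (hnorm_ge_0 l) as Pl.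
    set (d := e / (2 + hnorm l + K)).
    assert (Hd : 0 < d) by (apply Rdiv_lt_0_compat; lra).
    assert (Ed : d * (2 + hnorm l + K) = e) by (unfold d; field; lra).
    destruct (Hl d Hd) as (x & Hx & Hxl).
    pose proof (Rle_trans _ _ _ (Rle_abs _) (HC' (hsub x l))) as H1. rewrite Hsub in H1.
    pose proof (cauchy_schwarz l (hsub x l)) as CS. rewrite <- Rabs_Ropp in CS.
    pose proof (Rle_trans _ _ _ (Rle_abs _) CS) as H2.
    pose proof (hinner_pos E (hsub x l)) as P.
    assert (hnorm l * hnorm (hsub x l) <= hnorm l * d) by (apply Rmult_le_compat_l; lra).
    assert (K * hnorm (hsub x l) <= K * d) by (apply Rmult_le_compat_l; lra).
    revert H2 P. hexpand. rewrite (hinner_sym E x l). nra.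
  - exists z. assert (P : forall x, 0 <= hinner x z - ell x).
    { intro x. apply quadratic_slope_nonneg with (b := / 2 * hinner x x). intros t _.
      specialize (Hmu (hadd z (hscal t x)) _ (Rle_refl _)).
      assert (Hz' : / 2 * hinner z z - ell z <= mu) by (apply le_epsilon; exact Hz).
      rewrite Hadd, Hscal in Hmu. revert Hmu. hexpand. rewrite (hinner_sym E z x). nra. }
    intro x. pose proof (P x) as H1. pose proof (P (hscal (-1) x)) as H2.
    rewrite Hscal in H2. revert H2. hexpand. lra.
Qed.

(** * Constructions of Hilbert spaces *)

Section WeightedProduct.
Context (X Y : Hilbert) (w : posreal).
Implicit Types a b : X * Y.

Definition prod_inner a b := hinner (fst a) (fst b) + w * hinner (snd a) (snd b).
Definition prod_add a b := (hadd (fst a) (fst b), hadd (snd a) (snd b)).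
Definition prod_opp a := (hopp (fst a), hopp (snd a)).

Lemma prod_sub_inner_pos a b :
  0 <= prod_inner (prod_add a (prod_opp b)) (prod_add a (prod_opp b)).
Proof.
  pose proof (cond_pos w). unfold prod_inner.
  pose proof (hinner_pos X (fst (prod_add a (prod_opp b)))).
  pose proof (hinner_pos Y (snd (prod_add a (prod_opp b)))). nra.
Qed.

(** The weight sits on the second factor, so that iteration produces weighted sums. The definition
    is transparent because later proofs compute with the inner product. *)
Definition prodH : Hilbert.
Proof.
  refine (@Build_Hilbert (X * Y) (hzero, hzero) prod_add prod_opp
    (fun s a => (hscal s (fst a), hscal s (snd a))) prod_inner
    _ _ _ _ _ _ _ _ _ _ _ _ _
    (complete_of_sqr (fun a b => prod_inner (prod_add a (prod_opp b)) (prod_add a (prod_opp b)))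
      prod_sub_inner_pos _));
    unfold prod_inner, prod_add, prod_opp; simpl.
  - intros. f_equal; apply hadd_assoc.
  - intros. f_equal; apply hadd_comm.
  - intros [x y]. simpl. f_equal; apply hadd_0.
  - intros. f_equal; apply hadd_opp.
  - intros. f_equal; apply hscal_assoc.
  - intros [x y]. simpl. f_equal; apply hscal_1.
  - intros. f_equal; apply hscal_distr_v.
  - intros. f_equal; apply hscal_distr_s.
  - intros. rewrite (hinner_sym X (fst x)), (hinner_sym Y (snd x)). ring.
  - intros. hexpand. ring.
  - intros. hexpand. ring.
  - intros [x y]. simpl. pose proof (cond_pos w).
    pose proof (hinner_pos X x). pose proof (hinner_pos Y y). nra.
  - intros [x y]. simpl. intro E. pose proof (cond_pos w).
    pose proof (hinner_pos X x). pose proof (hinner_pos Y y).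
    f_equal; apply hinner_def; nra.
  - intros u Hu. pose proof (cond_pos w) as Pw.
    destruct (@complete_sqr X (fun n => fst (u n))) as [l1 H1].
    { intros e He. destruct (Hu e He) as [N HN]. exists N. intros n p Hn Hp.
      eapply Rle_lt_trans; [| exact (HN n p Hn Hp)].
      pose proof (hinner_pos Y (hadd (snd (u n)) (hopp (snd (u p))))). unfold hsub. nra. }
    destruct (@complete_sqr Y (fun n => snd (u n))) as [l2 H2].
    { intros e He. destruct (Hu (w * e)) as [N HN]; [nra |]. exists N. intros n p Hn Hp.
      apply Rmult_lt_reg_l with w; [easy |].
      eapply Rle_lt_trans; [| exact (HN n p Hn Hp)].
      pose proof (hinner_pos X (hadd (fst (u n)) (hopp (fst (u p))))). unfold hsub. nra. }
    exists (l1, l2). intros e He.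
    destruct (H1 (e / 2)) as [N1 HN1]; [lra |].
    destruct (H2 (/ w * (e / 2))) as [N2 HN2].
    { apply Rmult_lt_0_compat; [now apply Rinv_0_lt_compat | lra]. }
    exists (max N1 N2). intros n Hn.
    specialize (HN1 n ltac:(lia)). specialize (HN2 n ltac:(lia)). unfold hsub in *. simpl.
    apply Rmult_lt_compat_l with (r := w) in HN2; [| easy].
    rewrite <- Rmult_assoc, Rinv_r in HN2 by lra. lra.
Defined.

End WeightedProduct.

Section EquivalentInnerProduct.
Context (E : Hilbert) (b : E -> E -> R) (c C : R).
Hypothesis b_sym : forall x y, b x y = b y x.
Hypothesis b_add_l : forall x y z, b (hadd x y) z = b x z + b y z.
Hypothesis b_scal_l : forall s x y, b (hscal s x) y = s * b x y.
Hypothesis Hc : 0 < c.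
Hypothesis HC : 0 < C.
Hypothesis b_lower : forall x, c * hinner x x <= b x x.
Hypothesis b_upper : forall x, b x x <= C * hinner x x.

Lemma b_pos x : 0 <= b x x.
Proof. specialize (b_lower x). pose proof (hinner_pos E x). nra. Qed.

(** Vectors and operations are kept and only the inner product changes; the bounds [c] and [C] carry
    Cauchy sequences and limits between the two norms. *)
Definition renorm : Hilbert.
Proof.
  refine (@Build_Hilbert E hzero hadd hopp hscal b
    (hadd_assoc E) (hadd_comm E) (hadd_0 E) (hadd_opp E) (hscal_assoc E) (hscal_1 E)
    (hscal_distr_v E) (hscal_distr_s E) b_sym b_add_l b_scal_l b_pos _
    (complete_of_sqr (fun x y => b (hsub x y) (hsub x y)) (fun x y => b_pos _) _)).
  - intros x Hx. apply hinner_def. specialize (b_lower x). pose proof (hinner_pos E x). nra.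
  - intros u Hu. destruct (@complete_sqr E u) as [l Hl].
    + intros e He. destruct (Hu (c * e)) as [N HN]; [nra |]. exists N. intros n p Hn Hp.
      apply Rmult_lt_reg_l with c; [easy |]. eapply Rle_lt_trans; [apply b_lower | now apply HN].
    + exists l. intros e He. destruct (Hl (/ C * e)) as [N HN].
      { apply Rmult_lt_0_compat; [now apply Rinv_0_lt_compat | easy]. }
      exists N. intros n Hn. eapply Rle_lt_trans; [apply b_upper |].
      specialize (HN n Hn). apply Rmult_lt_compat_l with (r := C) in HN; [| easy].
      rewrite <- Rmult_assoc, Rinv_r in HN by lra. lra.
Defined.

End EquivalentInnerProduct.

(** * The primal-dual iteration *)

Section PrimalDual.
Context {H K : Hilbert} (C : H -> K) (Cs : K -> H).
Hypothesis C_add : forall x y, C (hadd x y) = hadd (C x) (C y).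
Hypothesis C_scal : forall s x, C (hscal s x) = hscal s (C x).
Hypothesis C_adj : forall x y, hinner (C x) y = hinner x (Cs y).
Context (kappa sigma tau : R).
Hypothesis kappa_ge_0 : 0 <= kappa.
Hypothesis C_bound : forall x, hinner (C x) (C x) <= kappa * hinner x x.
Hypothesis sigma_pos : 0 < sigma.
Hypothesis tau_pos : 0 < tau.
Hypothesis step_sizes : sigma * tau * kappa < 1.

Lemma C_sub x y : C (hsub x y) = hsub (C x) (C y).
Proof.
  replace (hsub x y) with (hadd x (hscal (-1) y)) by hvec.
  rewrite C_add, C_scal. hvec.
Qed.

Definition pd_inner (z z' : H * K) : R :=
  (/ tau + 1) * hinner (fst z) (fst z') + / sigma * hinner (snd z) (snd z')
  - hinner (C (fst z)) (snd z') - hinner (C (fst z')) (snd z).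

(** Young's inequality with a free weight: [a = sigma] gives domination of [|x|^2], a slightly
    larger weight gives coercivity, and [a = 1] the upper bound. *)
Lemma cross_term_bound (a : R) x y : 0 < a ->
  2 * hinner (C x) y <= a * kappa * hinner x x + / a * hinner y y.
Proof.
  intro Ha. pose proof (hinner_pos K (hsub (hscal a (C x)) y)) as P.
  apply Rmult_le_reg_l with a; [easy |].
  replace (a * (a * kappa * hinner x x + / a * hinner y y))
    with (a * a * (kappa * hinner x x) + hinner y y) by (field; lra).
  pose proof (C_bound x) as Q. apply Rmult_le_compat_l with (r := a * a) in Q; [| nra].
  revert P. hexpand. rewrite (hinner_sym K y (C x)). lra.
Qed.

Lemma kappa_le : sigma * kappa <= / tau.
Proof.
  apply Rmult_le_reg_l with tau; [easy |]. rewrite Rinv_r by lra. nra.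
Qed.

Lemma pd_inner_ge_fst x y : hinner x x <= pd_inner (x, y) (x, y).
Proof.
  unfold pd_inner; simpl. pose proof (cross_term_bound x y sigma_pos).
  pose proof (hinner_pos H x). pose proof kappa_le. nra.
Qed.

Let E0 : Hilbert := prodH H K (mkposreal 1 Rlt_0_1).

(** With [s = sigma * tau * kappa < 1], the Young weight [sigma * (2 - s)] exceeds [sigma], which
    leaves a positive coefficient on [|y|^2]; as [s * (2 - s) <= 1], the coefficient of [|x|^2]
    stays at least 1. *)
Let c0 : R := Rmin 1 (/ sigma - / (sigma * (2 - sigma * tau * kappa))).

Lemma c0_pos : 0 < c0.
Proof.
  unfold c0. set (s := sigma * tau * kappa) in *.
  apply Rmin_pos; [lra |].
  replace (/ sigma - / (sigma * (2 - s))) with ((1 - s) / (sigma * (2 - s))) by (field; lra).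
  apply Rdiv_lt_0_compat; [lra | apply Rmult_lt_0_compat; lra].
Qed.

Lemma pd_inner_lower (z : E0) : c0 * hinner z z <= pd_inner z z.
Proof.
  destruct z as [x y]. unfold pd_inner. simpl. unfold prod_inner. simpl.
  set (s := sigma * tau * kappa) in *.
  assert (Ha : 0 < sigma * (2 - s)) by (apply Rmult_lt_0_compat; lra).
  pose proof (cross_term_bound x y Ha) as P.
  pose proof (hinner_pos H x). pose proof (hinner_pos K y).
  pose proof c0_pos.
  assert (Q1 : c0 <= 1) by apply Rmin_l.
  assert (Q2 : c0 <= / sigma - / (sigma * (2 - s))) by apply Rmin_r.
  assert (Q3 : sigma * (2 - s) * kappa <= / tau).
  { apply Rmult_le_reg_l with tau; [easy |]. rewrite Rinv_r by lra.
    replace (tau * (sigma * (2 - s) * kappa)) with (s * (2 - s)) by (unfold s; ring).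
    pose proof (pow2_ge_0 (1 - s)). lra. }
  apply Rmult_le_compat_r with (r := hinner x x) in Q1; [| easy].
  apply Rmult_le_compat_r with (r := hinner x x) in Q3; [| easy].
  apply Rmult_le_compat_r with (r := hinner y y) in Q2; [| easy]. lra.
Qed.

Let c1 : R := (/ tau + 1 + kappa) + (/ sigma + 1).

Lemma c1_pos : 0 < c1.
Proof.
  unfold c1. pose proof (Rinv_0_lt_compat _ sigma_pos). pose proof (Rinv_0_lt_compat _ tau_pos).
  lra.
Qed.

Lemma pd_inner_upper (z : E0) : pd_inner z z <= c1 * hinner z z.
Proof.
  destruct z as [x y]. unfold pd_inner. simpl. unfold prod_inner. simpl.
  (* The sign of [x] is flipped because the cross term must now be bounded from below. *)
  pose proof (cross_term_bound (hscal (-1) x) y Rlt_0_1) as P.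
  rewrite C_scal in P. revert P. hexpand. rewrite Rinv_1. intro P.
  pose proof (hinner_pos H x). pose proof (hinner_pos K y).
  pose proof (Rinv_0_lt_compat _ sigma_pos). pose proof (Rinv_0_lt_compat _ tau_pos).
  unfold c1. nra.
Qed.

Lemma pd_inner_sym (z z' : E0) : pd_inner z z' = pd_inner z' z.
Proof.
  unfold pd_inner. rewrite (hinner_sym H (fst z)), (hinner_sym K (snd z)). ring.
Qed.

Lemma pd_inner_add_l (z z' v : E0) :
  pd_inner (hadd z z') v = pd_inner z v + pd_inner z' v.
Proof. unfold pd_inner. simpl. rewrite C_add. hexpand. ring. Qed.

Lemma pd_inner_scal_l s (z v : E0) : pd_inner (hscal s z) v = s * pd_inner z v.
Proof. unfold pd_inner. simpl. rewrite C_scal. hexpand. ring. Qed.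

Definition pd_space : Hilbert :=
  renorm E0 pd_inner pd_inner_sym pd_inner_add_l pd_inner_scal_l c0_pos c1_pos
    pd_inner_lower pd_inner_upper.

(** Testing the first component against [v] is a bounded functional for the new norm, hence
    represented in the new inner product by some [zeta]. *)
Lemma weak_cv_fst (z : nat -> pd_space) (l : pd_space) :
  weak_cv z l -> @weak_cv H (fun k => fst (z k)) (fst l).
Proof.
  intros Hz v.
  destruct (@riesz pd_space (fun z => hinner (fst z) v) (hnorm v)) as [zeta Hzeta].
  - intros a b. simpl. now hexpand.
  - intros s a. simpl. now hexpand.
  - intros [x y]. simpl. eapply Rle_trans; [apply cauchy_schwarz |].
    rewrite Rmult_comm. apply Rmult_le_compat_l; [apply hnorm_ge_0 |].
    apply sqrt_le_1_alt, pd_inner_ge_fst.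
  - intros e He. destruct (Hz zeta e He) as [N HN]. exists N. intros k Hk.
    rewrite 2!Hzeta. now apply HN.
Qed.

Context (A : H -> H -> Prop) (D : K -> K -> Prop) (F : H -> H) (ell : R).
Hypothesis A_monotone : forall x y u v, A x u -> A y v -> 0 <= hinner (hsub x y) (hsub u v).
Hypothesis D_monotone : forall x y u v, D x u -> D y v -> 0 <= hinner (hsub x y) (hsub u v).
Hypothesis A_resolvent : forall l u, 0 < l -> exists p, A p (hscal (/ l) (hsub u p)).
Hypothesis D_resolvent : forall l u, 0 < l -> exists p, D p (hscal (/ l) (hsub u p)).
Hypothesis ell_bounds : 0 < ell < 2.
Hypothesis F_cocoercive : forall x y,
  / ell * hinner (hsub (F x) (F y)) (hsub (F x) (F y)) <= hinner (hsub (F x) (F y)) (hsub x y).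

(** The two rows of the inclusion of [P (z - z') - (F x, 0)] in [M z'], where
    [M (x, y) = (A x + Cs y, D y - C x)]. The off-diagonal part of [P] removes [Cs y'] from the
    first row and creates the extrapolation [2 x' - x] in the second. *)
Definition pd_step (z z' : pd_space) : Prop :=
  A (fst z')
    (hsub (hsub (hscal (/ tau + 1) (hsub (fst z) (fst z'))) (Cs (snd z))) (F (fst z))) /\
  D (snd z')
    (hadd (hscal (/ sigma) (hsub (snd z) (snd z'))) (C (hsub (hscal 2 (fst z')) (fst z)))).

Lemma pd_step_total (z : pd_space) : exists z', pd_step z z'.
Proof.
  destruct z as [x y]. pose proof (Rinv_0_lt_compat _ tau_pos) as Pt.
  assert (Pt' : 0 < / (/ tau + 1)) by (apply Rinv_0_lt_compat; lra).
  destruct (@A_resolvent (/ (/ tau + 1)) (hsub x (hscal (/ (/ tau + 1)) (hadd (Cs y) (F x)))))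
    as [x' Hx']; [easy |].
  destruct (@D_resolvent sigma (hadd y (hscal sigma (C (hsub (hscal 2 x') x))))) as [y' Hy'];
    [easy |].
  exists (x', y'). split; simpl.
  - match goal with |- A _ ?u => match type of Hx' with A _ ?v => replace u with v end end;
      [easy |].
    hvec. field. split; nra.
  - match goal with |- D _ ?u => match type of Hy' with D _ ?v => replace u with v end end;
      [easy |].
    hvec. field. lra.
Qed.

(** For the differences [Z = (a, b)] and [Z' = (a', b')], monotonicity ([M1], [M2]) gives
    [P(Z', Z - Z') >= <a', d>]. By cocoercivity [M3] and Young's inequality [M4] the right side is
    at least [- ell / 4 |a - a'|^2], and [M5] absorbs this loss into the metric. *)
Lemma pd_step_averaged (z1 z1' z2 z2' : pd_space) : pd_step z1 z1' -> pd_step z2 z2' ->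
  hinner (hsub z1' z2') (hsub z1' z2') <= hinner (hsub z1 z2) (hsub z1 z2)
    - (1 - ell / 2) * hinner (hsub (hsub z1 z1') (hsub z2 z2')) (hsub (hsub z1 z1') (hsub z2 z2')).
Proof.
  destruct z1 as [x1 y1], z1' as [p1 q1], z2 as [x2 y2], z2' as [p2 q2].
  intros [Hx1 Hy1] [Hx2 Hy2]. simpl in Hx1, Hy1, Hx2, Hy2.
  pose proof (A_monotone Hx1 Hx2) as M1. pose proof (D_monotone Hy1 Hy2) as M2.
  pose proof (F_cocoercive x1 x2) as M3.
  change (pd_inner (hsub p1 p2, hsub q1 q2) (hsub p1 p2, hsub q1 q2)
    <= pd_inner (hsub x1 x2, hsub y1 y2) (hsub x1 x2, hsub y1 y2)
       - (1 - ell / 2) * pd_inner (hsub (hsub x1 p1) (hsub x2 p2), hsub (hsub y1 q1) (hsub y2 q2))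
           (hsub (hsub x1 p1) (hsub x2 p2), hsub (hsub y1 q1) (hsub y2 q2))).
  set (a := hsub x1 x2) in *. set (b := hsub y1 y2). set (d := hsub (F x1) (F x2)) in *.
  set (a' := hsub p1 p2) in *. set (b' := hsub q1 q2) in *.
  replace (hsub (hsub x1 p1) (hsub x2 p2)) with (hsub a a') by (unfold a, a'; hvec).
  replace (hsub (hsub y1 q1) (hsub y2 q2)) with (hsub b b') by (unfold b, b'; hvec).
  match type of M1 with 0 <= ?r => replace r with
    ((/ tau + 1) * hinner a' (hsub a a') - hinner (C a') b - hinner a' d) in M1 end.
  2:{ unfold a, a', b, d. rewrite !C_sub. hexpand. rewrite <- !C_adj. ring. }
  match type of M2 with 0 <= ?r => replace r with
    (/ sigma * hinner b' (hsub b b') + hinner b' (C (hsub (hscal 2 a') a))) in M2 end.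
  2:{ unfold a, a', b, b'. rewrite !C_sub, !C_scal, !C_sub. hexpand. ring. }
  assert (M4 : 0 <= / ell * hinner d d - hinner d (hsub a a')
                    + ell / 4 * hinner (hsub a a') (hsub a a')).
  { pose proof (hinner_pos H (hsub d (hscal (ell / 2) (hsub a a')))) as P.
    apply Rmult_le_reg_l with ell; [lra |].
    match goal with |- _ <= ?r => replace r with
      (hinner d d - ell * hinner d (hsub a a') + ell ^ 2 / 4 * hinner (hsub a a') (hsub a a'))
      by (field; lra) end.
    generalize dependent (hsub a a'). intros v P. revert P. hexpand.
    rewrite (hinner_sym H v d). lra. }
  assert (M5 : ell / 2 * hinner (hsub a a') (hsub a a')
    <= ell / 2 * pd_inner (hsub a a', hsub b b') (hsub a a', hsub b b')).
  { apply Rmult_le_compat_l; [lra | apply pd_inner_ge_fst]. }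
  clearbody a a' b b' d. clear - C_add C_scal M1 M2 M3 M4 M5.
  unfold pd_inner in *. simpl in *. revert M1 M2 M3 M4 M5. rewrite !C_sub, !C_scal. hexpand.
  rewrite (hinner_sym H a' a), (hinner_sym K b' b), (hinner_sym H a' d),
    (hinner_sym K b' (C a)), (hinner_sym K b' (C a')). lra.
Qed.

Theorem primal_dual_weak_cv (x : nat -> H) (y : nat -> K) (x0 : H) (y0 : K) :
  A x0 (hsub (hopp (Cs y0)) (F x0)) -> D y0 (C x0) ->
  (forall k, A (x (S k))
     (hsub (hsub (hscal (/ tau + 1) (hsub (x k) (x (S k)))) (Cs (y k))) (F (x k)))) ->
  (forall k, D (y (S k))
     (hadd (hscal (/ sigma) (hsub (y k) (y (S k)))) (C (hsub (hscal 2 (x (S k))) (x k))))) ->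
  exists xs ys, A xs (hsub (hopp (Cs ys)) (F xs)) /\ D ys (C xs) /\ weak_cv x xs.
Proof.
  intros HA HD Hx Hy.
  (* At a fixed point the increments vanish and the step becomes the primal-dual optimality
     system. *)
  assert (Efix1 : forall p q, hsub (hsub (hscal (/ tau + 1) (hsub p p)) (Cs q)) (F p)
    = hsub (hopp (Cs q)) (F p)) by (intros; hvec).
  assert (Efix2 : forall p q, hadd (hscal (/ sigma) (hsub q q)) (C (hsub (hscal 2 p) p)) = C p).
  { intros. replace (hsub (hscal 2 p) p) with p by hvec. hvec. }
  destruct (@averaged_orbit_weak_cv pd_space pd_step (1 - ell / 2) ltac:(lra)
    pd_step_total pd_step_averaged (fun k => (x k, y k)) (x0, y0)) as [[xs ys] [[H1 H2] Hcv]].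
  - intro k. split; simpl; [apply Hx | apply Hy].
  - split; simpl; [now rewrite Efix1 | now rewrite Efix2].
  - simpl in H1, H2. rewrite Efix1 in H1. rewrite Efix2 in H2. exists xs, ys.
    repeat split; auto. exact (weak_cv_fst Hcv).
Qed.

End PrimalDual.

(** * Operator norms, finite sums and the weighted dual space *)

Lemma opnorm_bound {H G : Hilbert} (B : H -> G) (x : H) :
  bounded_linear B -> hnorm (B x) <= opnorm B * hnorm x.
Proof.
  intros (_ & Bs & c & Hc).
  assert (Hb : bound (fun r => exists x, hnorm x <= 1 /\ r = hnorm (B x))).
  { exists (Rabs c). intros r (y & Hy & ->). eapply Rle_trans; [apply Hc |].
    pose proof (Rle_abs c). pose proof (Rabs_pos c). pose proof (hnorm_ge_0 y). nra. }
  assert (Hop : forall y, hnorm y <= 1 -> hnorm (B y) <= opnorm B).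
  { intros y Hy. unfold opnorm, esup. destruct (excluded_middle_informative _) as [P | P].
    - destruct (completeness _ _ _) as [m Hm]. simpl. apply (proj1 Hm). eauto.
    - exfalso. apply P. split; eauto. }
  destruct (Req_dec (hnorm x) 0) as [E | N].
  - rewrite E. specialize (Hc x). rewrite E in Hc. lra.
  - pose proof (hnorm_ge_0 x). assert (P : 0 < hnorm x) by lra.
    pose proof (Rinv_0_lt_compat _ P).
    specialize (Hop (hscal (/ hnorm x) x)). rewrite Bs, 2!hnorm_scal, Rabs_pos_eq in Hop by lra.
    rewrite Rinv_l in Hop by lra. specialize (Hop (Rle_refl 1)).
    apply Rmult_le_compat_r with (r := hnorm x) in Hop; [| easy].
    replace (/ hnorm x * hnorm (B x) * hnorm x) with (hnorm (B x)) in Hop by (field; lra).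
    lra.
Qed.

Definition unitH : Hilbert.
Proof.
  refine (@Build_Hilbert unit tt (fun _ _ => tt) (fun _ => tt) (fun _ _ => tt) (fun _ _ => 0)
    _ _ _ _ _ _ _ _ _ _ _ _ _ _);
    try (intros; repeat match goal with t : unit |- _ => destruct t end;
         solve [reflexivity | ring | apply Rle_refl]).
  intros _ _. exists tt. intros e He. exists 0%nat. intros. now rewrite sqrt_0.
Defined.

Lemma hsum_ext {H : Hilbert} (n : nat) (a b : nat -> H) :
  (forall i, (i < n)%nat -> a i = b i) -> hsum n a = hsum n b.
Proof.
  induction n as [| n IH]; simpl; intro E; [easy |]. rewrite IH, E; auto.
Qed.

Lemma rsum_ext (n : nat) (a b : nat -> R) :
  (forall i, (i < n)%nat -> a i = b i) -> rsum n a = rsum n b.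
Proof.
  induction n as [| n IH]; simpl; intro E; [easy |]. rewrite IH, E; auto.
Qed.

Lemma rsum_ge_0 (n : nat) (a : nat -> R) : (forall i, 0 <= a i) -> 0 <= rsum n a.
Proof.
  intro P. induction n as [| n IH]; simpl; [lra |]. specialize (P n). lra.
Qed.

Lemma hscal_hsum {H : Hilbert} (n : nat) (s : R) (a : nat -> H) :
  hscal s (hsum n a) = hsum n (fun i => hscal s (a i)).
Proof.
  induction n as [| n IH]; simpl; [hvec |]. now rewrite hscal_distr_v, IH.
Qed.

Section DualSpace.
Context (G : nat -> Hilbert) (w : nat -> posreal).

(** Nested pairs accommodate a family of different spaces; the resulting inner product is
    [sum_i w_i <y_i, z_i>] over [i < n]. *)
Fixpoint dual_space (n : nat) : Hilbert :=
  match n with O => unitH | S n => prodH (dual_space n) (G n) (w n) end.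

Fixpoint stack (n : nat) (y : forall i, G i) : dual_space n :=
  match n with O => tt | S n => (stack n y, y n) end.

Lemma stack_ext n (a b : forall i, G i) :
  (forall i, (i < n)%nat -> a i = b i) -> stack n a = stack n b.
Proof.
  induction n as [| n IH]; simpl; intro E; [easy |]. rewrite IH, E; auto.
Qed.

Lemma stack_add n (a b : forall i, G i) :
  stack n (fun i => hadd (a i) (b i)) = hadd (stack n a) (stack n b).
Proof. induction n as [| n IH]; simpl; [easy |]. now rewrite IH. Qed.

Lemma stack_scal n s (a : forall i, G i) :
  stack n (fun i => hscal s (a i)) = hscal s (stack n a).
Proof. induction n as [| n IH]; simpl; [easy |]. now rewrite IH. Qed.

Lemma stack_sub n (a b : forall i, G i) :
  stack n (fun i => hsub (a i) (b i)) = hsub (stack n a) (stack n b).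
Proof. unfold hsub. induction n as [| n IH]; simpl; [easy |]. now rewrite IH. Qed.

Context {H : Hilbert} (B : forall i, H -> G i) (Bs : forall i, G i -> H).

Definition stack_op (n : nat) (x : H) : dual_space n := stack n (fun i => B i x).

Fixpoint stack_adj (n : nat) : dual_space n -> H :=
  match n return dual_space n -> H with
  | O => fun _ => hzero
  | S n => fun z : dual_space n * G n => hadd (stack_adj n (fst z)) (hscal (w n) (Bs n (snd z)))
  end.

Lemma stack_adj_stack n (y : forall i, G i) :
  stack_adj n (stack n y) = hsum n (fun i => hscal (w i) (Bs i (y i))).
Proof. induction n as [| n IH]; simpl; [easy |]. now rewrite IH. Qed.

Lemma stack_op_adj n (x : H) (z : dual_space n) :
  (forall i, (i < n)%nat -> is_adjoint (B i) (Bs i)) ->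
  hinner (stack_op n x) z = hinner x (stack_adj n z).
Proof.
  unfold stack_op. induction n as [| n IH]; intro Hadj; simpl.
  - now rewrite hinner_0_r.
  - destruct z as [z y]. unfold prod_inner. simpl. hexpand. rewrite IH by auto.
    now rewrite (Hadj n (le_n _)).
Qed.

Lemma stack_op_bound n (x : H) :
  (forall i, (i < n)%nat -> bounded_linear (B i)) ->
  hinner (stack_op n x) (stack_op n x)
    <= rsum n (fun i => w i * opnorm (B i) ^ 2) * hinner x x.
Proof.
  unfold stack_op. induction n as [| n IH]; intro HB; simpl.
  - lra.
  - unfold prod_inner. simpl. specialize (IH (fun i Hi => HB i (le_S _ _ Hi))).
    pose proof (opnorm_bound x (HB n (le_n _))) as P. pose proof (cond_pos (w n)) as Pw.
    pose proof (hnorm_ge_0 (B n x)) as P0.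
    assert (Q : hinner (B n x) (B n x) <= opnorm (B n) ^ 2 * hinner x x).
    { rewrite <- !hnorm_sqr, <- Rpow_mult_distr. now apply pow_incr. }
    apply Rmult_le_compat_l with (r := w n) in Q; [| lra]. simpl in IH, Q |- *. lra.
Qed.

Context (h : forall i, G i -> ereal) (gamma : R).

(* The operator [y |-> prod_i (dh_i)^-1 (w_i y_i / gamma)], as a relation. *)
Fixpoint dual_rel (n : nat) : dual_space n -> dual_space n -> Prop :=
  match n return dual_space n -> dual_space n -> Prop with
  | O => fun _ _ => True
  | S n => fun z u : dual_space n * G n =>
      dual_rel n (fst z) (fst u) /\ subdiff (h n) (snd u) (hscal (w n / gamma) (snd z))
  end.

Lemma dual_rel_stack n (y u : forall i, G i) :
  (forall i, (i < n)%nat -> subdiff (h i) (u i) (hscal (w i / gamma) (y i))) ->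
  dual_rel n (stack n y) (stack n u).
Proof.
  induction n as [| n IH]; simpl; intro P; [easy |]. split; auto.
Qed.

Hypothesis gamma_pos : 0 < gamma.

(** The factor [w n / gamma] in [dual_rel] matches the weight of the inner product, so each block
    contributes [gamma] times a monotone pairing of [subdiff (h n)]. *)
Lemma dual_rel_monotone n (y z u v : dual_space n) :
  dual_rel n y u -> dual_rel n z v -> 0 <= hinner (hsub y z) (hsub u v).
Proof.
  induction n as [| n IH]; simpl.
  - intros. lra.
  - destruct y as [y y'], z as [z z'], u as [u u'], v as [v v']. simpl.
    intros [H1 H2] [H3 H4]. unfold prod_inner. simpl.
    pose proof (subdiff_monotone H2 H4) as P. specialize (IH _ _ _ _ H1 H3).
    pose proof (cond_pos (w n)) as Pw.
    apply Rplus_le_le_0_compat; [exact IH |].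
    change (0 <= w n * hinner (hsub y' z') (hsub u' v')).
    apply Rmult_le_reg_l with (/ gamma); [now apply Rinv_0_lt_compat |]. rewrite Rmult_0_r.
    eapply Rle_trans; [exact P |]. apply Req_le. rewrite (hinner_sym _ (hsub y' z')).
    hexpand. field. lra.
Qed.

Lemma dual_rel_resolvent n (l : R) (u : dual_space n) : 0 < l ->
  (forall i, (i < n)%nat -> Gamma0 (h i)) ->
  (forall i, (i < n)%nat -> exists x s, subdiff (h i) x s) ->
  exists p, dual_rel n p (hscal (/ l) (hsub u p)).
Proof.
  intros Hl. induction n as [| n IH]; intros Hh Hs; simpl.
  - now exists tt.
  - destruct u as [u v]. destruct (IH u) as [p Hp]; [auto | auto |].
    pose proof (cond_pos (w n)) as Pw.
    destruct (Hs n (le_n _)) as (x0 & s0 & Hs0). destruct (Hh n (le_n _)) as (_ & Hlsc & Hc).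
    (* Moreau's decomposition: the resolvent of the inverse relation at [v] is [v - l q], with [q] a
       resolvent point of the subdifferential itself. *)
    destruct (@subdiff_resolvent (G n) (h n) (gamma / (w n * l)) (hscal (/ l) v) x0 s0)
      as [q Hq]; auto.
    { apply Rdiv_lt_0_compat; nra. }
    exists (p, hsub v (hscal l q)). split; simpl; [exact Hp |].
    match type of Hq with subdiff _ _ ?s => replace s with
      (hscal (w n / gamma) (hsub v (hscal l q))) in Hq by (hvec; field; lra) end.
    replace (hscal (/ l) (hadd v (hopp (hsub v (hscal l q))))) with q; [easy |].
    hvec. field. lra.
Qed.

(** In the weighted inner product, [z / gamma] is a subgradient of the separable sum of the [h i] at
    [stack_op n x]. *)
Lemma dual_rel_subgradient n (z : dual_space n) (x : H) :
  dual_rel n z (stack_op n x) ->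
  exists a, esum n (fun i => h i (B i x)) = Fin a /\
    forall v b, esum n (fun i => h i (B i v)) = Fin b ->
      a + / gamma * hinner z (hsub (stack_op n v) (stack_op n x)) <= b.
Proof.
  unfold stack_op. induction n as [| n IH]; simpl.
  - intros _. exists 0. split; [easy |]. intros v b E. injection E as <-. lra.
  - destruct z as [z y]. simpl. intros [H1 H2].
    destruct (IH z H1) as (a & Ea & Ha). apply subdiff_iff in H2. destruct H2 as (a' & Ea' & Ha').
    exists (a + a'). rewrite Ea, Ea'. split; [easy |]. intros v b E.
    destruct (esum n (fun i => h i (B i v))) as [b1 |] eqn:E1; simpl in E; [| easy].
    destruct (h n (B n v)) as [b2 |] eqn:E2; simpl in E; [| easy].
    injection E as <-. specialize (Ha v b1 E1). specialize (Ha' _ _ E2).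
    unfold prod_inner. simpl. revert Ha'. rewrite hinner_scal_l. unfold hsub in Ha |- *. lra.
Qed.

End DualSpace.

(** * Weak convergence to a solution of (P) *)

Unset Implicit Arguments.

Theorem theorem4p6
  (H : Hilbert) (m : nat) (G : nat -> Hilbert)
  (f : H -> R) (df : H -> H) (L : R) (g : H -> ereal)
  (h : forall i, G i -> ereal)
  (B : forall i, H -> G i) (Bs : forall i, G i -> H)
  (* standing assumptions *)
  (HL : 0 < L)
  (Hfconv : convex_r f) (Hdf : is_gradient f df)
  (HLip : forall x y, hnorm (hsub (df x) (df y)) <= L * hnorm (hsub x y))
  (Hg : Gamma0 g)
  (Hh : forall i, (i < m)%nat -> Gamma0 (h i))
  (HB : forall i, (i < m)%nat -> bounded_linear (B i))
  (HBs : forall i, (i < m)%nat -> is_adjoint (B i) (Bs i))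
  (Hsol : exists (xh : H) (u : H) (v : forall i, G i),
      subdiff g xh u /\
      (forall i, (i < m)%nat -> subdiff (h i) (B i xh) (v i)) /\
      hadd (hadd (df xh) u) (hsum m (fun i => Bs i (v i))) = hzero)
  (* parameters *)
  (w : nat -> R)
  (Hw : forall i, (i < m)%nat -> 0 < w i < 1)
  (Hwsum : rsum m w = 1)
  (gamma sigma tau : R)
  (Hgamma : 0 < gamma < 2 / L)
  (Hsigma : 0 < sigma) (Htau : 0 < tau)
  (Hst : sigma * tau * rsum m (fun i => w i * (opnorm (B i))^2) < 1)
  (* iterates *)
  (x : nat -> H) (y : forall i, nat -> G i)
  (Hx : forall k,
      is_prox (tau * gamma / (1 + tau)) g
        (hscal (/ (1 + tau))
           (hadd (hsub (x k) (hscal tau (hsum m (fun i => hscal (w i) (Bs i (y i k))))))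
                 (hscal tau (hsub (x k) (hscal gamma (df (x k)))))))
        (x (S k)))
  (Hy : forall i k, (i < m)%nat ->
      exists p : G i,
        is_prox (w i * (sigma / gamma)) (fconj (h i))
          (hscal (w i / gamma)
             (hadd (y i k) (hscal sigma (B i (hsub (hscal 2 (x (S k))) (x k)))))) p /\
        y i (S k) = hscal (gamma / w i) p) :
  exists xs : H,
    (forall z : H,
       ele (eadd (eadd (Fin (f xs)) (g xs)) (esum m (fun i => h i (B i xs))))
           (eadd (eadd (Fin (f z)) (g z)) (esum m (fun i => h i (B i z))))) /\
    weak_cv x xs.
Proof.
  destruct Hsol as (xh & uh & vh & Huh & Hvh & Hopt).
  (* [dual_space] takes positive weights at every index, so the weights are continued by 1 from [m]
     on. *)
  set (w' := fun i => match lt_dec i m with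
    | left Hi => mkposreal (w i) (proj1 (Hw i Hi)) | right _ => mkposreal 1 Rlt_0_1 end).
  assert (Ew : forall i, (i < m)%nat -> w i = w' i).
  { intros i Hi. unfold w'. now destruct (lt_dec i m). }
  set (C := stack_op G w' B m). set (Cs := stack_adj G w' Bs m).
  assert (C_add : forall a b, C (hadd a b) = hadd (C a) (C b)).
  { intros a b. unfold C, stack_op. rewrite <- stack_add. apply stack_ext.
    intros i Hi. apply (HB i Hi). }
  assert (C_scal : forall s a, C (hscal s a) = hscal s (C a)).
  { intros s a. unfold C, stack_op. rewrite <- stack_scal. apply stack_ext.
    intros i Hi. apply (HB i Hi). }
  assert (C_adj : forall a z, hinner (C a) z = hinner a (Cs z)).
  { intros. now apply stack_op_adj. }
  assert (Hkappa : rsum m (fun i => w i * opnorm (B i) ^ 2)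
                   = rsum m (fun i => w' i * opnorm (B i) ^ 2)).
  { apply rsum_ext. intros i Hi. now rewrite Ew. }
  rewrite Hkappa in Hst.
  assert (gL : gamma * L < 2).
  { apply Rmult_lt_reg_r with (/ L); [now apply Rinv_0_lt_compat |].
    rewrite Rmult_assoc, Rinv_r by lra. lra. }
  assert (Hgi : 0 < / gamma) by (apply Rinv_0_lt_compat; lra).
  (* Instance: [A] is [gamma] times the subdifferential of [g], [F = gamma df] and
     [ell = gamma * L]. The assumed solution has dual variables [gamma v_i / w_i], whose image under
     [Cs] is [gamma sum_i Bs_i v_i]. *)
  destruct (@primal_dual_weak_cv H (dual_space G w' m) C Cs C_add C_scal
    C_adj (rsum m (fun i => w' i * opnorm (B i) ^ 2)) sigma tau
    (rsum_ge_0 m _ (fun i => Rmult_le_pos _ _ (Rlt_le _ _ (cond_pos (w' i))) (pow2_ge_0 _)))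
    (fun a => stack_op_bound G w' B a HB) Hsigma Htau Hst
    (fun p s => subdiff g p (hscal (/ gamma) s)) (dual_rel G w' h gamma m)
    (fun a => hscal gamma (df a)) (gamma * L))
    with (x := x) (y := fun k => stack G w' m (fun i => y i k)) (x0 := xh)
         (y0 := stack G w' m (fun i => hscal (gamma / w' i) (vh i)))
    as (xs & ys & HA & HD & Hcv).
  - intros a b u v Hu Hv. pose proof (subdiff_monotone Hu Hv) as P.
    apply Rmult_le_reg_l with (/ gamma); [easy |]. rewrite Rmult_0_r.
    eapply Rle_trans; [exact P |]. apply Req_le. hexpand. ring.
  - intros a b u v Hu Hv. eapply dual_rel_monotone; [| exact Hu | exact Hv]; lra.
  - intros l u Hl. destruct Hg as (_ & Hlsc & Hc).
    destruct (@subdiff_resolvent H g (l * gamma) u xh uh) as [p Hp]; auto; [nra |].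
    exists p. match type of Hp with subdiff _ _ ?s => match goal with |- subdiff _ _ ?t =>
      replace t with s end end; [easy |]. hvec. field. lra.
  - intros l u Hl. apply dual_rel_resolvent; auto; [lra |]. eauto.
  - split; [nra | easy].
  - intros a b. pose proof (baillon_haddad a b HL Hfconv Hdf HLip) as P.
    replace (hsub (hscal gamma (df a)) (hscal gamma (df b)))
      with (hscal gamma (hsub (df a) (df b))) by hvec.
    rewrite !hinner_scal_l, hinner_scal_r.
    apply Rmult_le_compat_l with (r := gamma) in P; [| lra].
    eapply Rle_trans; [| exact P]. apply Req_le. field. lra.
  - unfold Cs. rewrite stack_adj_stack.
    match goal with |- subdiff _ _ ?t => replace t with uh end; [easy |].
    apply hinner_ext. intro z.
    apply (f_equal (fun a => hinner a z)) in Hopt. revert Hopt.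
    replace (hsum m (fun i => hscal (w' i) (Bs i (hscal (gamma / w' i) (vh i)))))
      with (hscal gamma (hsum m (fun i => Bs i (vh i)))).
    + hexpand. intro Hopt.
      replace (hinner uh z) with (- (hinner (df xh) z + hinner (hsum m (fun i => Bs i (vh i))) z))
        by lra.
      field. lra.
    + rewrite hscal_hsum. apply hsum_ext. intros i Hi. pose proof (cond_pos (w' i)).
      hvec. rewrite !(hinner_sym _ (Bs i _)), <- !(HBs i Hi). hexpand. field. lra.
  - apply dual_rel_stack. intros i Hi. pose proof (cond_pos (w' i)).
    replace (hscal (w' i / gamma) (hscal (gamma / w' i) (vh i))) with (vh i); [auto |].
    hvec. field. lra.
  - intro k.
    assert (Hl : 0 < tau * gamma / (1 + tau)) by (apply Rdiv_lt_0_compat; nra).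
    (* The inverse proximal parameter is [(/ tau + 1) / gamma], which turns the prox argument into
       the first row of [pd_step]. *)
    destruct Hg as (Hpr & _ & Hc). pose proof (prox_subdiff Hpr Hc Hl (Hx k)) as P.
    match type of P with subdiff _ _ ?s => match goal with |- subdiff _ _ ?t =>
      replace t with s end end; [easy |].
    unfold Cs. rewrite stack_adj_stack.
    rewrite (@hsum_ext H m _ (fun i => hscal (w' i) (Bs i (y i k))))
      by (intros i Hi; now rewrite Ew).
    hvec. field. lra.
  - intro k. unfold C, stack_op. rewrite <- stack_sub, <- stack_scal, <- stack_add.
    apply dual_rel_stack. intros i Hi. destruct (Hy i k Hi) as (p & Hp & ->).
    destruct (Hh i Hi) as (_ & Hlsc & Hc). destruct (Hw i Hi) as [Hwi _].
    assert (Hl : 0 < w i * (sigma / gamma)).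
    { apply Rmult_lt_0_compat; [easy | apply Rdiv_lt_0_compat; lra]. }
    (* [p] is [w i / gamma] times the new dual iterate, so Moreau's identity yields the second row
       of [pd_step]. *)
    pose proof (prox_fconj_subdiff Hlsc Hc (Hvh i Hi) Hl Hp) as P.
    rewrite <- Ew by easy.
    replace (hscal (w i / gamma) (hscal (gamma / w i) p)) with p by (hvec; field; lra).
    match type of P with subdiff _ ?s _ => match goal with |- subdiff _ ?t _ =>
      replace t with s end end; [easy |].
    hvec. field. lra.
  - exists xs. split; [| exact Hcv]. intro z.
    (* The three subgradient inequalities at [xs], for [f], [g] and the composite sum, are added;
       the terms in [ys] cancel through the adjoint. *)
    apply subdiff_iff in HA. destruct HA as (a & Ea & HA).
    destruct (dual_rel_subgradient G w' B h gamma m ys xs HD) as (b & Eb & HB').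
    rewrite Ea, Eb. simpl.
    destruct (g z) as [a' |] eqn:Ea'; [| easy].
    destruct (esum m (fun i => h i (B i z))) as [b' |] eqn:Eb'; [| easy].
    specialize (HA z a' Ea'). specialize (HB' z b' Eb'). simpl.
    pose proof (gradient_inequality xs z Hfconv Hdf) as HF.
    revert HA HB' HF. fold C. hexpand.
    rewrite !(hinner_sym _ ys), !C_adj, (hinner_sym H z (Cs ys)), (hinner_sym H xs (Cs ys)).
    assert (E : forall r, / gamma * (gamma * r) = r) by (intro; field; lra).
    pose proof (E (hinner (df xs) z)). pose proof (E (hinner (df xs) xs)). lra.
Qed.
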